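(* Let $f:\mathbb{R}^d\to[0,\infty)$ be Lipschitz continuous with Lipschitz constant $L_f>0$ and have a unique global minimizer $x^*\in\mathbb{R}^d$; write $f^*=f(x^* )$. Let $x_{\rm in}$ be a random vector in $\mathbb{R}^d$ whose law $\rho$ is absolutely continuous with respect to Lebesgue measure, and let the initial data $\{x^{i,0}\}_{i\in[N]}$ of the ESCBO algorithm be i.i.d. with $x^{i,0}\sim x_{\rm in}$ for each $i\in[N]$. Assume $$(1-\lambda)^2+\delta^2<\frac12\quad\text{and}\quad\sum_{k=0}^\infty\alpha_k<\infty.$$ For some $\epsilon\in(0,1)$, suppose that the parameters $\{\beta,\lambda,\delta\}$, the step sizes $\{\alpha_k\}_{k\ge0}$ and the initial distribution satisfy $$(1-\epsilon)\,\mathbb{E}\left[\mathrm{e}^{-\beta f(x_{\rm in})}\right]\ge\beta L_fC_3\,\mathrm{e}^{-\beta f^*},$$ where $$C_3=\sum_{n=0}^{\infty}\left((\lambda+\delta)\sqrt{2\prod_{m=0}^{n-1}C_{1,m}\,\mathrm{Var}(x_{\rm in})}+\alpha_nM_g\right).$$ Then $$\left|\operatorname*{ess\,inf}_{\omega\in\Omega}f(x_\infty(\omega))-f^*\right|\le E(\beta)\quad\text{and}\quad\lim_{\beta\to\infty}E(\beta)=0,$$ where $x_\infty$ is the global consensus point, i.e. the random vector with $\lim_{k\to\infty}x^{i,k}=x_\infty$ almost surely for all $i\in[N]$, and $$E(\beta):=-\frac1\beta\log\mathbb{E}\left[\mathrm{e}^{-\beta f(x_{\rm in})}\right]-f^*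-\frac1\beta\log\epsilon.$$
   Context: $[N]=\{1,\dots,N\}$; $\|\cdot\|$ is the Euclidean norm; $\odot$ is the componentwise (Hadamard) product; $e_l$ is the $l$-th column of the identity matrix; $(\Omega,\mathcal F,\mathbb P)$ is the underlying probability space; empty products equal $1$; $\mathrm{Var}(x_{\rm in})=\mathbb{E}[\|x_{\rm in}\|^2]-\|\mathbb{E}[x_{\rm in}]\|^2$. Forward-difference gradient estimator with interval $\sigma>0$: $g(x)\in\mathbb{R}^d$ with $[g(x)]_l=\frac{f(x+\sigma e_l)-f(x)}{\sigma}$, $l\in[d]$. $M_g,L_g$ denote positive constants with $\|g(x)\|\le M_g$ and $\|g(x)-g(y)\|\le L_g\|x-y\|$ for all $x,y\in\mathbb{R}^d$ (the paper takes $M_g=\sqrt d\,L_f$, $L_g=2\sqrt d\,L_f/\sigma$). Set $C_{1,n}:=2\left((1-\lambda)^2+\delta^2+\alpha_n^2L_g^2\right)$. ESCBO algorithm: given $N$, initial points $x^{i,0}$ ($i\in[N]$), parameters $\beta>0$, $\lambda>0$, $\delta\ge0$, $\sigma>0$ and a nonnegative sequence $\{\alpha_k\}_{k\ge0}$, for $k=0,1,2,\dots$ set $$\bar x^{\star,k}=\frac{\sum_{i=1}^N x^{i,k}\mathrm{e}^{-\beta f(x^{i,k})}}{\sum_{i=1}^N \mathrm{e}^{-\beta f(x^{i,k})}},$$ draw a random vector $\eta^k=(\eta^k_1,\dots,\eta^k_d)^\top$ with i.i.d. components $\eta^k_l\sim\mathcal{N}(0,\delta^2)$ (the same $\eta^k$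 is used for all particles; $\eta^0,\eta^1,\dots$ are mutually independent and independent of the initial data), and for every $i\in[N]$ set $$y^{i,k+1}=x^{i,k}-\lambda(x^{i,k}-\bar x^{\star,k})-(x^{i,k}-\bar x^{\star,k})\odot\eta^k,\qquad x^{i,k+1}=y^{i,k+1}-\alpha_k\,g(x^{i,k}).$$ Under the Lipschitz assumption on $f$, $(1-\lambda)^2+\delta^2<1/2$ and $\sum_k\alpha_k<\infty$, the paper shows that the almost sure limit $x_\infty$ exists and is common to all particles.
   Formalization: The limit E(β)→0 is proved assuming in addition that x* lies in the support of the law of x_in; without this it can fail (d=1, f(x)=|x|, x_in uniform on [10,11], λ=1, δ=0, α_k=0, where E(β)→10). The error bound needs no added assumption. *)

(* Defs.v *)
From HB Require Import structures.
From mathcomp Require Import all_boot all_order all_algebra.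
From mathcomp Require Import all_classical all_reals all_analysis.

Set Implicit Arguments.
Unset Strict Implicit.
Unset Printing Implicit Defensive.

Import Order.TTheory GRing.Theory Num.Def Num.Theory.
Import numFieldNormedType.Exports.

Local Open Scope classical_set_scope.
Local Open Scope ring_scope.

Section euclidean_space.
Context {R : realType} {d : nat}.
Implicit Types (x y : 'rV[R]_d) (f : 'rV[R]_d -> R).

(* The library norm `|x| on row vectors is the sup norm. *)
Definition enorm x : R := Num.sqrt (\sum_(l < d) x 0 l ^+ 2).

Definition hadamard x y : 'rV[R]_d := \row_l (x 0 l * y 0 l).

Definition elipschitz (L : R) f :=
  forall x y, `|f x - f y| <= L * enorm (x - y).

Definition unique_global_minimizer f x :=
  (forall y, f x <= f y) /\ (forall y, (forall z, f y <= f z) -> y = x).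

Definition fd_grad f (sigma : R) x : 'rV[R]_d :=
  \row_(l < d) ((f (x + sigma *: delta_mx 0 l) - f x) / sigma).

End euclidean_space.

(* R^d with its Borel sigma-algebra; same carrier as 'rV[R]_d. *)
Notation rVborel R d := (g_sigma_algebraType (@open 'rV[R]_d)).

(* d-dimensional Lebesgue (outer) measure: infimum of the total volume of
   countable covers by closed axis-parallel boxes.
   This is only meaningful for 0 < d: when d = 0 every box has volume 1. *)
Section lebesgue.
Context {R : realType} {d : nat}.

Definition box (a b : 'rV[R]_d) : set 'rV[R]_d :=
  [set x | forall l, a 0 l <= x 0 l <= b 0 l].

Definition box_vol (a b : 'rV[R]_d) : R := \prod_(l < d) (b 0 l - a 0 l).

Definition lebesgue_rV (A : set (rVborel R d)) : \bar R :=
  ereal_inf [set v | exists a b : nat -> 'rV[R]_d,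
    [/\ forall k l, a k 0 l <= b k 0 l,
        A `<=` \bigcup_k box (a k) (b k) &
        v = (\sum_(0 <= k <oo) (box_vol (a k) (b k))%:E)%E] ].

(* Topological support of a measure. The Laplace principle
   - b^-1 * ln E[exp (- b * f X)] --> min f needs the minimizer of f to be in
   the support of the law of X; absolute continuity of that law is not enough,
   as for d = 1, f = `|_| and X uniform on [10, 11]. *)
Definition support_rV (mu : set (rVborel R d) -> \bar R) : set 'rV[R]_d :=
  [set x | forall U : set 'rV[R]_d, open U -> U x -> (0 < mu U)%E].

End lebesgue.

Section probability.
Context {disp : measure_display} {T : measurableType disp} {R : realType}.
Variable P : probability T R.

(* Mutual independence of a family of classes of events. *)
Definition mutually_independent (I : choiceType) (F : I -> set (set T)) :=
  forall (J : seq I) (A : I -> set T), uniq J ->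
    (forall i, i \in J -> F i (A i)) ->
    P (\bigcap_(i in [set` J]) A i) = (\prod_(i <- J) P (A i))%E.

(* The law N(m, s^2), the Dirac mass at m when s = 0; the library's
   normal_prob m 0 is the uniform law on [0, 1] instead. *)
Definition gaussian_law (m s : R) (B : set R) : \bar R :=
  if s == 0 then \d_m B else normal_prob m s B.

Definition same_law {disp' : measure_display} {T' : measurableType disp'}
    (X Y : {RV P >-> T'}) :=
  forall B, measurable B -> distribution P X B = distribution P Y B.

Definition sigma_of {disp' : measure_display} {T' : measurableType disp'}
    (X : {RV P >-> T'}) : set (set T) :=
  preimage_set_system setT X measurable.

(* E[|X|^2] - |E[X]|^2. If E[|X|^2] = +oo then the value is +oo whether or not
   E[X] exists, because fine makes the second term a real number. *)
Definition variance_rV {d : nat} (X : T -> 'rV[R]_d) : \bar R :=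
  ('E_P[fun w => (enorm (X w) ^+ 2)%R]
   - (enorm (\row_(l < d) fine 'E_P[fun w => X w 0 l]) ^+ 2)%:E)%E.

End probability.

Section escbo.
Context {R : realType} {d : nat}.
Variables (f : 'rV[R]_d -> R) (beta lambda sigma : R) (alpha : R^nat).

Definition consensus {N : nat} (X : 'I_N -> 'rV[R]_d) : 'rV[R]_d :=
  (\sum_(i < N) expR (- beta * f (X i)))^-1 *:
    \sum_(i < N) expR (- beta * f (X i)) *: X i.

Definition escbo_step {N : nat} (a : R) (eta : 'rV[R]_d)
    (X : 'I_N -> 'rV[R]_d) (i : 'I_N) : 'rV[R]_d :=
  let y := X i - lambda *: (X i - consensus X)
             - hadamard (X i - consensus X) eta in
  y - a *: fd_grad f sigma (X i).

Fixpoint escbo {N : nat} (x0 : 'I_N -> 'rV[R]_d) (eta : nat -> 'rV[R]_d)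
    (k : nat) : 'I_N -> 'rV[R]_d :=
  if k is k'.+1 then escbo_step (alpha k') (eta k') (escbo x0 eta k')
  else x0.

End escbo.

Section error_estimate.
Context {disp : measure_display} {T : measurableType disp} {R : realType}.
Variable P : probability T R.
Context {d : nat}.
Variable xin : T -> 'rV[R]_d.

Definition C1 (lambda delta Lg : R) (alpha : R^nat) (n : nat) : R :=
  2 * ((1 - lambda) ^+ 2 + delta ^+ 2 + alpha n ^+ 2 * Lg ^+ 2).

(* Extended-real valued: it is +oo when the variance of xin is infinite. *)
Definition C3 (lambda delta Mg Lg : R) (alpha : R^nat) : \bar R :=
  (\sum_(0 <= n <oo)
     ((lambda + delta)%:E *
        sqrte (2%:E * (\prod_(0 <= m < n) C1 lambda delta Lg alpha m)%:E
               * variance_rV P xin)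
      + (alpha n * Mg)%:E))%E.

Definition laplace (f : 'rV[R]_d -> R) (beta : R) : \bar R :=
  'E_P[fun w => expR (- beta * f (xin w))%R]%E.

Definition error (f : 'rV[R]_d -> R) (fstar eps beta : R) : R :=
  - beta^-1 * ln (fine (laplace f beta)) - fstar - beta^-1 * ln eps.

End error_estimate.

(* Main.v *)
From HB Require Import structures.
Require Import Defs.
From mathcomp Require Import all_boot all_order all_algebra.
From mathcomp Require Import all_classical all_reals all_analysis.
From mathcomp Require Import ess_sup_inf measurable_realfun.
From mathcomp Require Import ring lra.

Set Implicit Arguments.
Unset Strict Implicit.
Unset Printing Implicit Defensive.

Import Order.TTheory GRing.Theory Num.Def Num.Theory.
Import numFieldNormedType.Exports.

Local Open Scope classical_set_scope.
Local Open Scope ring_scope.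

(* Write w_i = exp (- beta f(x^i)) and u_i = x^i - xbar. Since f is
   Lf-Lipschitz, one step costs at most beta Lf w_i |x^{i,k+1} - x^{i,k}| in
   w_i, so only the weighted displacements (1/N) sum_i w_i |u_i| have to be
   controlled. The weight is essential: xbar is the w-weighted mean, hence
   sum_i w_i |u_i|^2 is at most the average over j of sum_i w_i |x^i - x^j|^2,
   and thus (1/N) sum_i w_i |u_i|^2 <= exp (- beta f^* ) D_k where
   D_k = (1/N^2) sum_ij |x^i - x^j|^2. The unweighted (1/N) sum_i |u_i|^2 has
   no such bound, as xbar may sit at an outlier.
   The consensus point cancels in x^i - x^j, which gives
   E[D_{k+1}] <= C_{1,k} E[D_k], and E[D_0] <= 2 Var(x_in). Summing over k,
   E[exp (- beta f(x_infty))] >= eps E[exp (- beta f(x_in))], and the bound on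
   the essential infimum follows; the limit of E(beta) is Laplace's
   principle. *)

(** * Euclidean norm and weighted means *)

(** The square root in [C3] is Cauchy-Schwarz: the drift towards the consensus point and the noise
    cost [lambda] and [delta] times the root of the bound on E[D_k], and the gradient costs at most
    [Mg] times the step size. In [C1], (1 - lambda)^2 + delta^2 bounds the second moment of
    [1 - lambda - eta], and the factor 2 is the price of separating this from the gradient
    difference. The probabilistic obstacle is that the noise of step k multiplies quantities
    depending on all earlier randomness. The iterates are therefore shown measurable for the
    sigma-algebra generated by the initial data and the noise before step k, and independence is
    extended from events of single variables to that sigma-algebra. Since the noise acts
    componentwise, the expectations are factored coordinate by coordinate. Most expectations are
    integrals of nonnegative functions in the extended reals, and losses are put on the larger side
    as added terms, so integrability is rarely an issue. The passage to x_infty is dominated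
    convergence: the average of the w_i never exceeds its value at the minimum of f. *)

Section enorm.
Context {R : realType} {d : nat}.
Implicit Types (x y : 'rV[R]_d) (a : R).

Lemma enorm_ge0 x : 0 <= enorm x.
Proof. exact: sqrtr_ge0. Qed.

Lemma enorm_sqr x : enorm x ^+ 2 = \sum_(l < d) x 0 l ^+ 2.
Proof. by rewrite sqr_sqrtr// sumr_ge0// => l _; exact: sqr_ge0. Qed.

Lemma enormZ a x : enorm (a *: x) = `|a| * enorm x.
Proof.
rewrite /enorm -sqrtr_sqr -sqrtrM ?sqr_ge0// mulr_sumr; congr Num.sqrt.
by apply: eq_bigr => l _; rewrite mxE exprMn.
Qed.

Lemma enormN x : enorm (- x) = enorm x.
Proof. by rewrite -scaleN1r enormZ normrN normr1 mul1r. Qed.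

Lemma coord_le_enorm x l : `|x 0 l| <= enorm x.
Proof.
rewrite -sqrtr_sqr ler_wsqrtr// (bigD1 l)//= lerDl sumr_ge0// => j _.
exact: sqr_ge0.
Qed.

(** Cauchy-Schwarz: summing (|y| x_l - |x| y_l)^2 >= 0 over l bounds 2 |x| |y| <x, y> by 2 |x|^2
    |y|^2. Dividing by |x| |y| requires treating vanishing norms apart. *)
Lemma dot_le_enorm x y : \sum_(l < d) x 0 l * y 0 l <= enorm x * enorm y.
Proof.
have [x0|x0] := eqVneq (enorm x) 0.
  rewrite x0 mul0r big1// => l _.
  have := coord_le_enorm x l; rewrite x0 normr_le0 => /eqP ->.
  by rewrite mul0r.
have [y0|y0] := eqVneq (enorm y) 0.
  rewrite y0 mulr0 big1// => l _.
  have := coord_le_enorm y l; rewrite y0 normr_le0 => /eqP ->.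
  by rewrite mulr0.
have {}x0 : 0 < enorm x by rewrite lt_neqAle eq_sym x0 enorm_ge0.
have {}y0 : 0 < enorm y by rewrite lt_neqAle eq_sym y0 enorm_ge0.
have xy0 : 0 < 2 * enorm x * enorm y by rewrite !mulr_gt0.
rewrite -(ler_pM2l xy0) mulr_sumr.
apply: (@le_trans _ _ (\sum_(l < d)
    (enorm y ^+ 2 * x 0 l ^+ 2 + enorm x ^+ 2 * y 0 l ^+ 2))).
  apply: ler_sum => l _.
  have := sqr_ge0 (enorm y * x 0 l - enorm x * y 0 l); lra.
rewrite big_split/= -!mulr_sumr -!enorm_sqr; lra.
Qed.

Lemma enormD x y : enorm (x + y) <= enorm x + enorm y.
Proof.
rewrite -(@ler_pXn2r _ 2)// ?nnegrE ?addr_ge0 ?enorm_ge0//.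
rewrite sqrrD !enorm_sqr.
under eq_bigr do rewrite mxE sqrrD.
rewrite !big_split/= lerD2r lerD2l.
rewrite mulr2n lerD//; exact: dot_le_enorm.
Qed.

End enorm.

(** * Weighted means and pairwise distances *)

Section weighted_mean.
Context {R : realType} {d N : nat}.
Implicit Types (w : 'I_N -> R) (X : 'I_N -> 'rV[R]_d).

(** Parallel-axis identity: the gap is exactly (sum of w) (m - c)^2, the cross term vanishing
    because m is the weighted mean. *)
Lemma weighted_mean_min w (t : 'I_N -> R) (m c : R) :
  (forall i, 0 <= w i) -> (\sum_i w i) * m = \sum_i w i * t i ->
  \sum_i w i * (t i - m) ^+ 2 <= \sum_i w i * (t i - c) ^+ 2.
Proof.
move=> w0 wm; rewrite -subr_ge0.
suff -> : \sum_i w i * (t i - c) ^+ 2 - \sum_i w i * (t i - m) ^+ 2 =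
    (\sum_i w i) * (m - c) ^+ 2.
  by rewrite mulr_ge0 ?sqr_ge0// sumr_ge0.
rewrite -sumrB.
rewrite (eq_bigr (fun i => (2 * (m - c)) * (w i * t i) -
    w i * ((m - c) * (m + c)))); last by move=> i _; ring.
rewrite sumrB -mulr_sumr -wm -mulr_suml; ring.
Qed.

Lemma weighted_mean_min_enorm w X (c : 'rV[R]_d) :
  (forall i, 0 <= w i) -> \sum_i w i != 0 ->
  \sum_i w i * enorm (X i - (\sum_i w i)^-1 *: \sum_i w i *: X i) ^+ 2 <=
  \sum_i w i * enorm (X i - c) ^+ 2.
Proof.
move=> w0 W0; set xb := _^-1 *: _.
have E (z : 'rV[R]_d) : \sum_i w i * enorm (X i - z) ^+ 2 =
    \sum_l \sum_i w i * (X i 0 l - z 0 l) ^+ 2.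
  rewrite exchange_big/=; apply: eq_bigr => i _.
  rewrite enorm_sqr mulr_sumr; apply: eq_bigr => l _.
  by rewrite !mxE.
rewrite !E; apply: ler_sum => l _; apply: weighted_mean_min => //.
rewrite /xb mxE mulrA mulfV// mul1r summxE; apply: eq_bigr => i _.
by rewrite mxE.
Qed.

(** With s_i = x_i - c in one coordinate, the double sum of (s_i - s_j)^2 equals 2 N sum s_i^2 - 2
    (sum s_i)^2, and the last square is dropped. *)
Lemma sum_sqr_dist_le X (c : 'rV[R]_d) :
  \sum_i \sum_j enorm (X i - X j) ^+ 2 <=
  2 * N%:R * \sum_i enorm (X i - c) ^+ 2.
Proof.
have E1 : \sum_i \sum_j enorm (X i - X j) ^+ 2 =
    \sum_l \sum_i \sum_j (X i 0 l - X j 0 l) ^+ 2.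
  rewrite [RHS]exchange_big/=. apply: eq_bigr => i _.
  rewrite exchange_big/=; apply: eq_bigr => j _.
  by rewrite enorm_sqr; apply: eq_bigr => l _; rewrite !mxE.
have E2 : \sum_i enorm (X i - c) ^+ 2 =
    \sum_l \sum_i (X i 0 l - c 0 l) ^+ 2.
  rewrite exchange_big/=; apply: eq_bigr => i _.
  by rewrite enorm_sqr; apply: eq_bigr => l _; rewrite !mxE.
rewrite E1 E2 mulr_sumr; apply: ler_sum => l _.
pose s i := X i 0 l - c 0 l.
rewrite [leLHS](_ : _ = 2 * N%:R * (\sum_i s i ^+ 2) - 2 * (\sum_i s i) ^+ 2).
  by rewrite gerBl mulr_ge0// sqr_ge0.
rewrite (eq_bigr (fun i => N%:R * s i ^+ 2 + \sum_j s j ^+ 2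
    - (2 * \sum_j s j) * s i)).
  rewrite sumrB big_split/= -!mulr_sumr sumr_const card_ord -mulr_natl; ring.
move=> i _.
rewrite (eq_bigr (fun j => s i ^+ 2 + s j ^+ 2 - (2 * s i) * s j)).
  rewrite sumrB big_split/= -!mulr_sumr sumr_const card_ord -mulr_natl; ring.
by move=> j _; rewrite /s; ring.
Qed.

(* The weighted mean minimises the weighted sum of squares, so it may be
   replaced by any particle [X j], and then averaged over [j]; this avoids
   comparing the weights with one another. *)
Lemma weighted_spread_le w X (e : R) :
  (forall i, 0 <= w i <= e) -> \sum_i w i != 0 ->
  N%:R^-1 * \sum_i w i * enorm (X i - (\sum_i w i)^-1 *: \sum_i w i *: X i) ^+ 2
  <= e * (N%:R^-1 ^+ 2 * \sum_i \sum_j enorm (X i - X j) ^+ 2).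
Proof.
move=> we W0.
have w0 i : 0 <= w i by have /andP[] := we i.
have [N0|N0] := eqVneq (N%:R : R) 0.
  by rewrite N0 invr0 expr0n/= !mul0r mulr0.
have Np : 0 < N%:R :> R by rewrite lt_neqAle eq_sym N0 ler0n.
set S := \sum_i w i * _.
have NS : N%:R * S <= e * \sum_i \sum_j enorm (X i - X j) ^+ 2.
  have -> : N%:R * S = \sum_(j < N) S.
    by rewrite sumr_const card_ord mulr_natl.
  rewrite [X in e * X]exchange_big/= mulr_sumr; apply: ler_sum => j _.
  apply: (le_trans (weighted_mean_min_enorm X (X j) w0 W0)).
  rewrite mulr_sumr; apply: ler_sum => i _; rewrite ler_wpM2r ?sqr_ge0//.
  by have /andP[] := we i.
rewrite -(ler_pM2l (exprn_gt0 2 Np)).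
have -> : N%:R ^+ 2 * (N%:R^-1 * S) = N%:R * S by field.
set Q := \sum_i \sum_j _ in NS *.
by have -> : N%:R ^+ 2 * (e * (N%:R^-1 ^+ 2 * Q)) = e * Q by field.
Qed.

End weighted_mean.

(** * Pathwise estimates for one step *)

Section escbo_step_bounds.
Context {R : realType} {d N : nat}.
Variables (f : 'rV[R]_d -> R) (beta lambda sigma a : R).
Implicit Types (X : 'I_N -> 'rV[R]_d) (h : 'rV[R]_d).

Local Notation wt X := (fun i => expR (- beta * f (X i))).

(** The tangent inequality 1 + t <= exp t is taken at x, the old position, so the loss keeps the old
    weight as a factor. That weight is what the weighted mean can exploit, and it depends on the
    past only. *)
Lemma laplace_weight_lip (L : R) x y : 0 <= beta -> elipschitz L f ->
  expR (- beta * f x) <=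
  expR (- beta * f y) + beta * L * (expR (- beta * f x) * enorm (y - x)).
Proof.
move=> b0 fL; rewrite -lerBlDr.
have -> : expR (- beta * f x) - beta * L * (expR (- beta * f x) * enorm (y - x))
   = expR (- beta * f x) * (1 + - (beta * L * enorm (y - x))) by ring.
have -> : - beta * f y = - beta * f x + - (beta * (f y - f x)) by ring.
rewrite expRD ler_wpM2l ?expR_ge0//.
apply: (le_trans _ (expR_ge1Dx _)); rewrite lerD2l lerN2 -mulrA ler_wpM2l//.
exact: le_trans (ler_norm _) (fL _ _).
Qed.

Lemma escbo_step_sub h X i :
  enorm (escbo_step f beta lambda sigma a h X i - X i) <=
  `|lambda| * enorm (X i - consensus f beta X)
   + enorm (hadamard (X i - consensus f beta X) h)
   + `|a| * enorm (fd_grad f sigma (X i)).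
Proof.
set u := X i - _.
have -> : escbo_step f beta lambda sigma a h X i - X i =
    - (lambda *: u) + - hadamard u h + - (a *: fd_grad f sigma (X i)).
  by apply/rowP => l; rewrite /escbo_step !mxE -/u /u; ring.
by rewrite -!enormZ -(enormN (lambda *: u)) -(enormN (hadamard u h))
  -(enormN (a *: _)) (le_trans (enormD _ _))// lerD2r enormD.
Qed.

(* The consensus point is common to both particles and cancels. *)
Lemma escbo_step_dist (Lg : R) h X i j :
  0 <= Lg ->
  (forall x y,
    enorm (fd_grad f sigma x - fd_grad f sigma y) <= Lg * enorm (x - y)) ->
  enorm (escbo_step f beta lambda sigma a h X i -
         escbo_step f beta lambda sigma a h X j) ^+ 2 <=
  2 * (\sum_(l < d) (X i - X j) 0 l ^+ 2 * (1 - lambda - h 0 l) ^+ 2)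
  + 2 * (a ^+ 2 * Lg ^+ 2) * \sum_(l < d) (X i - X j) 0 l ^+ 2.
Proof.
move=> Lg0 gL; set D := X i - X j; set g := fd_grad f sigma.
apply: (@le_trans _ _ (2 * (\sum_(l < d) D 0 l ^+ 2 * (1 - lambda - h 0 l) ^+ 2)
   + 2 * (a ^+ 2 * (\sum_(l < d) (g (X i) - g (X j)) 0 l ^+ 2)))).
  rewrite enorm_sqr !mulr_sumr -big_split/=; apply: ler_sum => l _.
  rewrite /escbo_step -/g /D; move: (consensus f beta X) (g (X i)) (g (X j)).
  move=> c gi gj; rewrite !mxE.
  (* The coordinate difference after the step is p - q, with p the contracted difference and q the
     gradient part; 2 p^2 + 2 q^2 - (p - q)^2 = (p + q)^2. *)
  have := sqr_ge0 ((1 - lambda - h 0 l) * (X i 0 l - X j 0 l) + a * (gi 0 l - gj 0 l)).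
  lra.
rewrite lerD2l -(mulrA 2) -(mulrA (a ^+ 2)) ler_wpM2l// ler_wpM2l ?sqr_ge0//.
rewrite -!enorm_sqr -exprMn ler_pXn2r// ?nnegrE ?enorm_ge0//.
by rewrite mulr_ge0 ?enorm_ge0.
Qed.

Lemma sum_weight_gt0 X : (0 < N)%N -> 0 < \sum_i wt X i.
Proof.
move=> N0; rewrite (bigD1 (Ordinal N0))//= ltr_wpDr ?expR_gt0//.
by rewrite sumr_ge0// => i _; exact: expR_ge0.
Qed.

Lemma consensus_spread_le X (fs : R) : (0 < N)%N -> 0 <= beta ->
  (forall x, fs <= f x) ->
  N%:R^-1 * \sum_i wt X i * enorm (X i - consensus f beta X) ^+ 2 <=
  expR (- beta * fs) * (N%:R^-1 ^+ 2 * \sum_i \sum_j enorm (X i - X j) ^+ 2).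
Proof.
move=> N0 b0 fsf; apply: weighted_spread_le.
  by move=> i; rewrite expR_ge0 ler_expR !mulNr lerN2 ler_wpM2l.
by rewrite gt_eqF// sum_weight_gt0.
Qed.

End escbo_step_bounds.

(** * Measurability of the iterates *)

Section measurability_rV.
Context {R : realType} {d : nat}.

Lemma rVborel_continuous_measurable (g : 'rV[R]_d -> R) : continuous g ->
  measurable_fun [set: rVborel R d] (g : rVborel R d -> R).
Proof.
move=> /continuousP cg; apply: (measurability _ (RGenOpens.measurableE R)).
move=> _ [_ [a [b ->]] <-]; rewrite setTI; apply: sub_sigma_algebra.
exact/cg/interval_open.
Qed.

Lemma rVborel_coord_measurable (l : 'I_d) :
  measurable_fun [set: rVborel R d] (fun x : rVborel R d => (x : 'rV[R]_d) 0 l).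
Proof. by apply: rVborel_continuous_measurable; exact: coord_continuous. Qed.

(** An open set is the union of the cubes with rational centre and radius 1/(n+1) that it contains.
    There are countably many, and the preimage of each is a finite intersection of coordinate
    events. *)
Lemma rVborel_measurable_fun {disp : measure_display}
    {T : measurableType disp} (X : T -> 'rV[R]_d) :
  (forall l, measurable_fun setT (fun w => X w 0 l)) ->
  measurable_fun setT (X : T -> rVborel R d).
Proof.
move=> mX; apply: (@measurability _ _ _ (rVborel R d) setT X
  (@open 'rV[R]_d)) => // _ [U oU <-].
pose B (z : 'rV[rat]_d * nat) :=
  [set x : 'rV[R]_d | forall l, `|ratr (z.1 0 l) - x 0 l| < z.2.+1%:R^-1].
have -> : U = \bigcup_z (if `[< B z `<=` U >] then B z else set0).
  rewrite eqEsubset; split=> [x Ux|x [z _]]; last by case: asboolP => // BU; exact: BU.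
  have /nbhs_ballP[e /= e0 xU] : nbhs x U by exact: open_nbhs_nbhs.
  (* Half of e, because a point y of the cube is compared with x through the rational centre. *)
  have e20 : 0 < e / 2 by rewrite divr_gt0.
  have [n _ /(_ n (leqnn n))/= en] := near_infty_natSinv_lt (PosNum e20).
  have /choice[q qx] : forall l : 'I_d, exists q : rat,
      `|ratr q - x 0 l| < n.+1%:R^-1.
    move=> l; have : x 0 l - n.+1%:R^-1 < x 0 l + n.+1%:R^-1.
      by rewrite ltrBlDr -addrA ltrDl addr_gt0// invr_gt0.
    move=> /rat_in_itvoo[q]; rewrite in_itv/= => /andP[q1 q2].
    by exists q; rewrite ltr_distl q1.
  exists (\row_l q l, n) => //; rewrite asboolT.
    by move=> l /=; rewrite mxE.
  move=> y /= By; apply: xU; split => // i l; rewrite ord1 /ball/=.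
  have := By l; rewrite mxE => qy; rewrite -(subrK (ratr (q l)) (x 0 l)) -addrA.
  rewrite (le_lt_trans (ler_normD _ _))// (splitr e) ltrD//.
    by rewrite distrC; exact: lt_trans en.
  exact: lt_trans en.
rewrite setTI preimage_bigcup; apply: countable_bigcupT_measurable => [|z].
  exact: countableP.
case: asboolP => _; last by rewrite preimage_set0.
have -> : X @^-1` B z = \bigcap_(l in [set: 'I_d])
    ((fun w => X w 0 l) @^-1` ball (ratr (z.1 0 l) : R) z.2.+1%:R^-1).
  by rewrite eqEsubset; split=> w Bw l; [move=> _|]; exact: Bw.
apply: fin_bigcap_measurable => // l _.
by rewrite -[X in measurable X]setTI; apply: mX => //; exact: measurable_ball.
Qed.

Lemma measurable_sqrtr (D : set R) : measurable_fun D (@Num.sqrt R).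
Proof.
apply: measurable_funTS; apply: continuous_measurable_fun.
exact: sqrt_continuous.
Qed.

(** Neighbourhoods are those of the sup norm, whence the comparison factor sqrt d. The added 1 keeps
    the divisor of e positive even if [L] or [d] is 0. *)
Lemma elipschitz_continuous (f : 'rV[R]_d -> R) (L : R) :
  elipschitz L f -> continuous f.
Proof.
move=> fL x; apply/(@cvgrPdist_le _ _ _ (nbhs x) (nbhs_filter x)) => e e0.
have L0 : 0 < `|L| * Num.sqrt d%:R + 1 by rewrite ltr_wpDl// mulr_ge0.
have r0 := divr_gt0 e0 L0; have := nbhsx_ballx x _ r0.
apply: filterS => y [_ xy]; apply: (le_trans (fL _ _)).
have xyr : enorm (x - y) <= Num.sqrt d%:R * (e / (`|L| * Num.sqrt d%:R + 1)).
  move: (e / _) r0 xy => r /ltW r0 xy.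
  rewrite -(@ler_pXn2r _ 2)// ?nnegrE ?enorm_ge0 ?mulr_ge0//.
  rewrite enorm_sqr exprMn sqr_sqrtr// -[d in d%:R]card_ord mulr_natl -sumr_const.
  apply: ler_sum => l _; rewrite -real_normK ?num_real//.
  rewrite ler_pXn2r ?nnegrE ?normr_ge0//.
  by have /ltW := xy 0 l; rewrite !mxE.
apply: (@le_trans _ _ (`|L| * enorm (x - y))).
  by rewrite ler_wpM2r ?enorm_ge0// ler_norm.
apply: (le_trans (ler_wpM2l _ xyr)) => //.
by rewrite !mulrA ler_pdivrMr// mulrC mulrDr mulr1 lerDl ltW.
Qed.

End measurability_rV.

Section escbo_measurability.
Context {R : realType} {d N : nat} {disp : measure_display}
  {T : measurableType disp}.
Variables (f : 'rV[R]_d -> R) (L : R).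
Hypothesis fL : elipschitz L f.
Implicit Type X : T -> 'rV[R]_d.
Local Notation mcoord X := (forall l, measurable_fun setT (fun w => X w 0 l)).

Lemma measurable_lipschitz_comp X : mcoord X ->
  measurable_fun setT (fun w => f (X w)).
Proof.
move=> mX.
have := rVborel_continuous_measurable (elipschitz_continuous fL).
move/measurableT_comp; apply; exact: rVborel_measurable_fun.
Qed.

Lemma measurable_enorm X : mcoord X ->
  measurable_fun setT (fun w => enorm (X w)).
Proof.
move=> mX; rewrite /enorm; apply: measurableT_comp; first exact: measurable_sqrtr.
by apply: measurable_sum => l; apply: measurable_funX; exact: mX.
Qed.

Lemma measurable_laplace_weight (beta : R) X : mcoord X ->
  measurable_fun setT (fun w => expR (- beta * f (X w))).
Proof.
move=> mX; apply: measurableT_comp => //; apply: measurable_funM => //.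
exact: measurable_lipschitz_comp.
Qed.

Lemma measurable_fd_grad (sigma : R) X : mcoord X ->
  mcoord (fun w => fd_grad f sigma (X w)).
Proof.
move=> mX l; under eq_fun do rewrite mxE.
apply: measurable_funM => //; apply: measurable_funB; last first.
  exact: measurable_lipschitz_comp.
apply: measurable_lipschitz_comp => j; under eq_fun do rewrite mxE.
exact: measurable_funD.
Qed.

Lemma measurable_consensus (beta : R) (X : T -> 'I_N -> 'rV[R]_d) :
  (forall i, mcoord (X ^~ i)) -> mcoord (fun w => consensus f beta (X w)).
Proof.
move=> mX l; under eq_fun do rewrite mxE summxE.
apply: measurable_funM; last first.
  apply: measurable_sum => i; under eq_fun do rewrite mxE.
  by apply: measurable_funM; [exact: measurable_laplace_weight|exact: mX].
(* The inverse of the total weight is read as a real power with exponent -1, a measurable function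
   of its base. *)
under eq_fun do rewrite -powR_inv1 ?sumr_ge0//.
apply: (measurableT_comp (measurable_powR _)).
by apply: measurable_sum => i; exact: measurable_laplace_weight.
Qed.

Lemma measurable_escbo_step (beta lambda sigma a : R)
    (X : T -> 'I_N -> 'rV[R]_d) (h : T -> 'rV[R]_d) i :
  (forall i, mcoord (X ^~ i)) -> mcoord h ->
  mcoord (fun w => escbo_step f beta lambda sigma a (h w) (X w) i).
Proof.
move=> mX mh l; have mc := measurable_consensus beta mX.
have mg := measurable_fd_grad sigma (mX i).
rewrite /escbo_step.
rewrite (_ : (fun w => _) = fun w => X w i 0 l -
    lambda * (X w i 0 l - consensus f beta (X w) 0 l) -
    (X w i 0 l - consensus f beta (X w) 0 l) * h w 0 l -
    a * fd_grad f sigma (X w i) 0 l); last first.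
  apply/funext => w; move: (consensus _ _ _) (fd_grad _ _ _) => c g.
  by rewrite !mxE.
apply: measurable_funB; last by apply: measurable_funM => //; exact: mg.
apply: measurable_funB; last first.
  by apply: measurable_funM => //; apply: measurable_funB; [exact: mX|exact: mc].
apply: measurable_funB; first exact: mX.
by apply: measurable_funM => //; apply: measurable_funB; [exact: mX|exact: mc].
Qed.

(** The measurable space is arbitrary and only the noise with index below k has to be measurable, so
    that the lemma applies to the sigma-algebra of the past, for which the noise of step k need not
    be measurable. *)
Lemma measurable_escbo (beta lambda sigma : R) (alpha : R^nat)
    (X : T -> 'I_N -> 'rV[R]_d) (h : T -> nat -> 'rV[R]_d) k i :
  (forall i, mcoord (X ^~ i)) -> (forall j, (j < k)%N -> mcoord (h ^~ j)) ->
  mcoord (fun w => escbo f beta lambda sigma alpha (X w) (h w) k i).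
Proof.
move=> mX; elim: k i => [|k IH] i mh l /=; first exact: mX.
apply: measurable_escbo_step => [j|]; last exact: mh.
by apply: IH => m mk; apply: mh; exact: ltnW.
Qed.

End escbo_measurability.

(** * Second moment of the Gaussian noise *)

Section gaussian.
Context {R : realType}.
Implicit Types (m s : R).
Local Notation mu := lebesgue_measure.

(** Change of variables holds with the Radon-Nikodym derivative, which agrees almost everywhere with
    [normal_pdf] because both have the same integral over every measurable set. *)
Lemma ge0_integral_normal_prob m s (h : R -> \bar R) :
  (forall y, 0 <= h y)%E -> measurable_fun [set: R] h ->
  (\int[normal_prob m s]_y h y = \int[mu]_y (h y * (normal_pdf m s y)%:E))%E.
Proof.
move=> h0 mh.
have dom : normal_prob m s `<< mu := normal_prob_dominates m s.
rewrite -(Radon_Nikodym_SigmaFinite.change_of_variables dom)//.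
apply: ae_eq_integral => //.
- apply: emeasurable_funM => //.
  exact: measurable_int (Radon_Nikodym_SigmaFinite.f_integrable dom).
- apply: emeasurable_funM => //.
  by apply/measurable_EFinP; exact: measurable_normal_pdf.
- apply: ae_eqe_mul2l; apply: integral_ae_eq => //.
  + exact: Radon_Nikodym_SigmaFinite.f_integrable.
  + by apply/measurable_EFinP; exact: measurable_normal_pdf.
  + by move=> A _ mA; rewrite -Radon_Nikodym_SigmaFinite.f_integral.
Qed.

(* [1 + t y ^ 2 <= expR (t y ^ 2)], with [t] chosen so that multiplying the
   N(0, s^2) density by the right-hand side gives [r] times that of
   N(0, (r s)^2); the second moment follows from the normalisations alone. *)
Lemma normal_pdf_sqr_le s r y : 0 < s -> 1 < r ->
  normal_pdf 0 s y * (1 + (1 - r^-1 ^+ 2) / (2 * s ^+ 2) * y ^+ 2) <=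
  r * normal_pdf 0 (r * s) y.
Proof.
move=> s0 r1; have r0 : 0 < r by exact: lt_trans r1.
have pdfE x : 0 < x -> normal_pdf 0 x y = normal_peak x * normal_fun 0 x y.
  by move=> x0; rewrite normal_pdfE ?gt_eqF.
rewrite !pdfE ?mulr_gt0//.
have -> : normal_peak (r * s) = r^-1 * normal_peak s.
  rewrite /normal_peak exprMn -mulrA -mulrnAr sqrtrM ?sqr_ge0// sqrtr_sqr.
  by rewrite gtr0_norm// invfM.
have -> : r * (r^-1 * normal_peak s * normal_fun 0 (r * s) y) =
    normal_peak s * normal_fun 0 (r * s) y by field; rewrite gt_eqF.
rewrite -[leLHS]mulrA; apply: ler_wpM2l; first exact: normal_peak_ge0.
rewrite /normal_fun !subr0.
have -> : - y ^+ 2 / ((r * s) ^+ 2 *+ 2) =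
    - y ^+ 2 / (s ^+ 2 *+ 2) + (1 - r^-1 ^+ 2) / (2 * s ^+ 2) * y ^+ 2.
  by field; rewrite !gt_eqF.
by rewrite expRD ler_wpM2l ?expR_ge0// expR_ge1Dx.
Qed.

(** Integrating [normal_pdf_sqr_le] bounds the second moment I by 2 s^2 r^2 / (r + 1) for every r >
    1, and this tends to s^2 as r tends to 1. *)
Lemma normal_prob_second_moment_le s : 0 < s ->
  (\int[normal_prob 0 s]_y (y ^+ 2)%:E <= (s ^+ 2)%:E)%E.
Proof.
move=> s0.
have msq : measurable_fun setT (fun y : R => (y ^+ 2)%:E).
  by apply/measurable_EFinP; exact: exprn_measurable.
have I0 : (0 <= \int[normal_prob 0%R s]_y (y ^+ 2)%:E)%E.
  by apply: integral_ge0 => y _; rewrite lee_fin sqr_ge0.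
have key r : 1 < r -> (1%:E + ((1 - r^-1 ^+ 2) / (2 * s ^+ 2))%:E *
    \int[normal_prob 0%R s]_y (y ^+ 2)%:E <= r%:E)%E.
  move=> r1; have r0 : 0 < r by exact: lt_trans r1.
  have c0 : 0 <= (1 - r^-1 ^+ 2) / (2 * s ^+ 2).
    apply: divr_ge0; last by rewrite mulr_ge0// sqr_ge0.
    by rewrite subr_ge0 exprn_ile1 ?invr_ge0 ?invf_le1 ?(ltW r0) ?(ltW r1).
  have mpdf x : measurable_fun [set: R] (fun y => (normal_pdf 0 x y)%:E).
    by apply/measurable_EFinP; exact: measurable_normal_pdf.
  have pdf0 x y : (0 <= (normal_pdf 0%R x y)%:E)%E.
    by rewrite lee_fin normal_pdf_ge0.
  have sq0 (y : R) : (0 <= (y ^+ 2)%:E)%E by rewrite lee_fin sqr_ge0.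
  have msqpdf : measurable_fun [set: R]
      (fun y => (y ^+ 2)%:E * (normal_pdf 0%R s y)%:E)%E.
    exact: emeasurable_funM.
  rewrite ge0_integral_normal_prob// -ge0_integralZl_EFin//; last first.
    by move=> y _; rewrite mule_ge0.
  rewrite -(integral_normal_pdf 0 s) -ge0_integralD//; last 3 first.
  - exact: mpdf.
  - by move=> y _; rewrite mule_ge0// mule_ge0.
  - by apply: measurable_funeM.
  rewrite -[leRHS]mule1 -(integral_normal_pdf 0 (r * s)).
  rewrite -ge0_integralZl_EFin ?(ltW r0)//; last exact: mpdf.
  apply: ge0_le_integral => //.
  - by move=> y _; rewrite adde_ge0// mule_ge0// mule_ge0.
  - apply: emeasurable_funD; first exact: mpdf.
    exact: measurable_funeM.
  - by apply: measurable_funeM; exact: mpdf.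
  - move=> y _; rewrite -!EFinM -EFinD lee_fin.
    by apply: le_trans (normal_pdf_sqr_le y s0 r1); lra.
(* One value of r, here 2, already makes the moment finite; real arithmetic is possible
   afterwards. *)
have : (\int[normal_prob 0%R s]_y (y ^+ 2)%:E)%E \is a fin_num.
  rewrite ge0_fin_numE//; have := key 2 ltac:(lra).
  have : 0 < (1 - 2^-1 ^+ 2) / (2 * s ^+ 2).
    by rewrite divr_gt0 ?mulr_gt0 ?exprn_gt0//; lra.
  case: (\int[_]_y _)%E I0 => [x| |]//= _ c0; first by rewrite ltry.
  by rewrite gt0_muley ?lte_fin.
move: I0 key; case: (\int[_]_y _)%E => // I; rewrite !lee_fin => I0 key _.
apply/ler_addgt0Pl => e e0; rewrite addrC.
(* For r = 1 + h the bound is 2 s^2 (1 + h)^2 / (2 + h), at most s^2 (1 + 2 h); the choice of h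
   turns this into s^2 + e. *)
have {key} /(_ (1 + e / (2 * s ^+ 2))) := key.
set h := e / _ => key; have h0 : 0 < h by rewrite divr_gt0// mulr_gt0// exprn_gt0.
have -> : e = 2 * s ^+ 2 * h by rewrite /h mulrC divfK// mulf_neq0// sqrf_eq0 gt_eqF.
have := key ltac:(lra); rewrite -EFinM -EFinD lee_fin.
have -> : (1 - (1 + h)^-1 ^+ 2) / (2 * s ^+ 2) * I =
   h * ((2 + h) * I / ((1 + h)^+2 * (2 * s ^+ 2))).
  by field; rewrite !gt_eqF//; lra.
rewrite lerD2l ger_pMr//  ler_pdivrMr ?mul1r; last first.
  by rewrite !mulr_gt0 ?exprn_gt0//; lra.
have s20 : 0 < s ^+ 2 by rewrite exprn_gt0.
move: (s ^+ 2) s20 => q q0 H.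
rewrite -(@ler_pM2l _ (2 + h)); last lra.
apply: le_trans H _; nra.
Qed.

(** The line is cut at 0 and the substitution y -> - y exchanges the half-lines; counting the point
    0 in both changes no integral. *)
Lemma ge0_integral_oppr (G : R -> R) : (forall y, 0 <= G y) ->
  continuous G ->
  (\int[mu]_y (G (- y))%:E = \int[mu]_y (G y)%:E)%E.
Proof.
move=> G0 cG.
have mG : measurable_fun setT G by exact: continuous_measurable_fun.
have mGN : measurable_fun setT (G \o -%R).
  exact: measurableT_comp.
have U : [set: R] = `]-oo, 0] `|` `]0, +oo[.
  by rewrite -itv_bndbnd_setU// set_itvNyy.
have D : [disjoint `]-oo, (0 : R)]%classic & `]0, +oo[%classic].
  apply/eqP; rewrite eqEsubset; split=> // y [] /=; rewrite !in_itv/= andbT.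
  by move=> /le_lt_trans/[apply]; rewrite ltxx.
have split_int (F : R -> R) : (forall y, 0 <= F y) -> measurable_fun setT F ->
  (\int[mu]_y (F y)%:E = \int[mu]_(y in `]-oo, 0%R]) (F y)%:E +
    \int[mu]_(y in `[0%R, +oo[) (F y)%:E)%E.
  move=> F0 mF; rewrite U ge0_integral_setU//; last 2 first.
  - apply/measurable_EFinP; exact: measurable_funTS.
  - by move=> y _; rewrite lee_fin.
  congr (_ + _)%E; rewrite integral_itv_obnd_cbnd//.
  by apply/measurable_EFinP; exact: measurable_funTS.
rewrite (split_int G)// (split_int (G \o -%R)) => [||]//; last by move=> y; exact: G0.
rewrite addeC; congr (_ + _)%E.
  rewrite -{2}oppr0 ge0_integration_by_substitutionNy//.
  exact: continuous_subspaceT.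
rewrite -{1}oppr0 (@ge0_integration_by_substitutionNy _ (G \o -%R))//.
- by apply: eq_integral => y _; rewrite /= opprK.
- apply: continuous_subspaceT => y; apply: continuous_comp; last exact: cG.
  exact: opp_continuous.
- by move=> y _; exact: G0.
Qed.

(** By symmetry of the density, c may be replaced by - c. Adding the two integrals cancels the cross
    term pointwise, (c - y)^2 + (- c - y)^2 = 2 c^2 + 2 y^2, so the first moment never appears. *)
Lemma normal_prob_sqr_le (c : R) s : 0 < s ->
  (\int[normal_prob 0 s]_y ((c - y) ^+ 2)%:E <= (c ^+ 2 + s ^+ 2)%:E)%E.
Proof.
move=> s0.
have cB b : continuous (fun y : R => b - y).
  by move=> y; apply: (@cvgB _ R^o); [exact: cvg_cst|exact: cvg_id].
have csq b : continuous (fun y : R => (b - y) ^+ 2).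
  move=> y; apply: (cvg_comp (fun y => b - y) (fun y => y ^+ 2)); first exact: cB.
  exact: sqr_continuous.
have msq b : measurable_fun setT (fun y : R => ((b - y) ^+ 2)%:E).
  by apply/measurable_EFinP; exact: continuous_measurable_fun.
have sym : (\int[normal_prob 0%R s]_y ((c - y) ^+ 2)%:E =
            \int[normal_prob 0%R s]_y ((- c - y) ^+ 2)%:E)%E.
  rewrite !ge0_integral_normal_prob//; try by move=> y; rewrite lee_fin sqr_ge0.
  under eq_integral do rewrite -EFinM.
  rewrite -(@ge0_integral_oppr (fun y => (c - y) ^+ 2 * normal_pdf 0 s y)).
  - apply: eq_integral => y _; rewrite -EFinM !normal_pdfE ?gt_eqF//.
    by rewrite /normal_fun !subr0 opprK sqrrN; congr (_ * _)%:E; ring.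
  - by move=> y; rewrite mulr_ge0 ?sqr_ge0 ?normal_pdf_ge0.
  - move=> y; apply: cvgM; first exact: csq.
    by apply: continuous_normal_pdf; rewrite gt_eqF.
have : (\int[normal_prob 0%R s]_y ((c - y) ^+ 2)%:E +
        \int[normal_prob 0%R s]_y ((c - y) ^+ 2)%:E <=
        (2 * c ^+ 2 + 2 * s ^+ 2)%:E)%E.
  rewrite {2}sym -ge0_integralD//; last 4 first.
  - by move=> y _; rewrite lee_fin sqr_ge0.
  - exact: msq.
  - by move=> y _; rewrite lee_fin sqr_ge0.
  - exact: msq.
  have -> : (\int[normal_prob 0%R s]_y (((c - y) ^+ 2)%:E + ((- c - y) ^+ 2)%:E) =
     \int[normal_prob 0%R s]_y (cst (2 * c ^+ 2)%:E y + 2%:E * (y ^+ 2)%:E))%E.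
    by apply: eq_integral => y _; rewrite -!EFinM -!EFinD; congr EFin; ring.
  have msq0 : measurable_fun setT (fun y : R => (y ^+ 2)%:E).
    by apply/measurable_EFinP; exact: exprn_measurable.
  rewrite ge0_integralD//; last 3 first.
  - by move=> y _; rewrite lee_fin mulr_ge0// sqr_ge0.
  - by move=> y _; rewrite -EFinM lee_fin mulr_ge0// sqr_ge0.
  - exact: measurable_funeM.
  rewrite integral_cst// [X in (_ * X + _)%E](_ : _ = 1%E); last first.
    exact: (@probability_setT _ _ _ (normal_prob 0 s)).
  rewrite mule1 [leRHS]EFinD leeD2l// [leRHS]EFinM.
  rewrite ge0_integralZl_EFin//; last by move=> y _; rewrite lee_fin sqr_ge0.
  by rewrite lee_wpmul2l//; exact: normal_prob_second_moment_le.
case: (\int[_]_y _)%E => [I| |].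
- by rewrite -EFinD !lee_fin => ?; lra.
- by rewrite addye.
- by move=> _; rewrite leNye.
Qed.

End gaussian.

Lemma gaussian_sqr_le {R : realType} {disp : measure_display}
    {T : measurableType disp} (P : probability T R) (Y : {RV P >-> R})
    (c s : R) : 0 <= s ->
  (forall B, measurable B -> distribution P Y B = gaussian_law 0 s B) ->
  (\int[P]_w ((c - Y w) ^+ 2)%:E <= (c ^+ 2 + s ^+ 2)%:E)%E.
Proof.
move=> s0 Ylaw.
have msq : measurable_fun setT (fun y : R => ((c - y) ^+ 2)%:E).
  apply/measurable_EFinP; apply: measurable_funX; exact: measurable_funB.
have mY : measurable_fun setT (Y : T -> measurableTypeR R).
  exact: (@measurable_funPT _ _ _ _ Y).
have <- : (\int[pushforward P (Y : T -> measurableTypeR R)]_y ((c - y) ^+ 2)%:E =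
    \int[P]_w ((c - Y w) ^+ 2)%:E)%E.
  rewrite ge0_integral_pushforward//.
  by move=> y _; rewrite lee_fin sqr_ge0.
move: Ylaw; rewrite /gaussian_law; have [-> Ylaw|sN0 Ylaw] := eqVneq s 0.
  rewrite (@eq_measure_integral _ _ _ setT (\d_(0 : measurableTypeR R)))//; last first.
    by move=> A mA _; exact: Ylaw.
  by rewrite integral_dirac// diracE in_setT mul1e subr0 expr0n addr0.
rewrite (@eq_measure_integral _ _ _ setT (normal_prob 0 s))//; last first.
  by move=> A mA _; exact: Ylaw.
by apply: normal_prob_sqr_le; rewrite lt_neqAle eq_sym sN0.
Qed.

(** * Independence *)

Section independence.
Context {disp : measure_display} {T : measurableType disp} {R : realType}.
Variable P : probability T R.
Context {I : choiceType}.
Variable F : I -> set (set T).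
Hypothesis F_measurable : forall i A, F i A -> measurable A.
Hypothesis F_setT : forall i, F i setT.
Hypothesis F_setI : forall i, setI_closed (F i).
Hypothesis F_indep : mutually_independent P F.

(** A pi-system generating the sigma-algebra of the subfamily indexed by [J]; its generated
    sigma-algebra plays the role of the past. *)
Definition joint_events (J : seq I) : set (set T) :=
  [set \bigcap_(i in [set` J]) A i | A in [set A : I -> set T | forall i, F i (A i)]].

Lemma joint_events_setT J : joint_events J setT.
Proof.
by exists (fun=> setT) => //; rewrite bigcapT.
Qed.

Lemma joint_events_setI J : setI_closed (joint_events J).
Proof.
move=> _ _ [A FA <-] [B FB <-]; exists (fun i => A i `&` B i).
  by move=> i; exact: F_setI.
by rewrite bigcapI.
Qed.

Lemma joint_events_measurable J A : joint_events J A -> measurable A.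
Proof.
move=> [B FB <-]; apply: fin_bigcap_measurable => // i _.
exact: F_measurable (FB i).
Qed.

Lemma joint_events_sub (J : seq I) i : i \in J -> F i `<=` joint_events J.
Proof.
move=> iJ A FA; exists (fun k => if k == i then A else setT).
  by move=> k /=; case: eqP => [->|_].
rewrite eqEsubset; split=> w.
  by move=> /(_ i)/=; rewrite eqxx; exact.
by move=> Aw k /= _; case: ifP.
Qed.

(** Pi-lambda argument: the finite measures P (. [&] B) and P B * P (.) agree on the pi-system of
    joint events, hence on the sigma-algebra it generates. *)
Lemma indep_joint_events (J : seq I) j A B : uniq (j :: J) ->
  <<s joint_events J >> A -> F j B -> P (A `&` B) = (P A * P B)%E.
Proof.
move=> jJ sA FB; have mB := F_measurable FB.
have PB0 : 0 <= fine (P B) by rewrite fine_ge0.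
transitivity (mscale (NngNum PB0) P A); last first.
  by rewrite /mscale/= fineK ?fin_num_measure// muleC.
apply: (g_sigma_algebra_measure_unique (joint_events J) _ (fun=> setT) _ _
  (mrestr P mB) (mscale (NngNum PB0) P)) sA => //.
- exact: joint_events_measurable.
- by move=> _; exact: joint_events_setT.
- by rewrite bigcup_const.
- exact: joint_events_setI.
- move=> _ [C FC <-]; rewrite /= /mrestr /mscale/= fineK ?fin_num_measure//.
  have jNJ : j \notin J by case/andP: jJ.
  (* [B] is placed at index j of the family; as j is not in [J], the events [C] are undisturbed. *)
  have := F_indep (A := fun i => if i == j then B else C i) jJ.
  rewrite big_cons eqxx (eq_big_seq (fun i => P (C i))); last first.
    by move=> i iJ; case: eqP => // ij; move: jNJ; rewrite -ij iJ.
  rewrite -(F_indep (A := C)) => [|//|//]; last by case/andP: jJ.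
  move=> <-; last by move=> i _; case: eqP => [->|].
  congr (P _); rewrite eqEsubset; split=> w /=.
    move=> [Cw Bw] i /=; rewrite inE; case: eqP => //= _ iJ; exact: Cw.
  move=> Aw; split; last by have := Aw j; rewrite /= mem_head eqxx; exact.
  move=> i /= iJ; have := Aw i; rewrite /= inE iJ orbT.
  by case: eqP => [ij|_]; [move: jNJ; rewrite -ij iJ|exact].
- by move=> _; rewrite /mrestr (le_lt_trans (probability_le1 _ _)) ?ltry// setTI.
Qed.

(** The identity of [T], seen as a map into [T] with the coarser sigma-algebra, is a random element
    independent of [Y]. The pair thus has a product law, and Tonelli factors the integral. *)
Lemma expectation_indepM (J : seq I) j (Y : {RV P >-> R})
    (U : T -> R) (h : R -> R) :
  uniq (j :: J) -> sigma_of Y `<=` F j ->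
  measurable_fun setT (U : g_sigma_algebraType (joint_events J) -> R) ->
  (forall w, 0 <= U w) ->
  measurable_fun setT h -> (forall y, 0 <= h y) ->
  (\int[P]_w (U w * h (Y w))%:E =
   \int[P]_w (U w)%:E * \int[P]_w (h (Y w))%:E)%E.
Proof.
move=> jJ YF mU U0 mh h0.
pose T' : measurableType _ := g_sigma_algebraType (joint_events J).
pose i0 : T -> T' := id.
have mi0 : measurable_fun setT i0.
  move=> _ A sA; rewrite setTI; move: A sA.
  apply: smallest_sub; first exact: sigma_algebra_measurable.
  exact: joint_events_measurable.
pose i1 : {mfun T >-> T'} := HB.pack i0 (isMeasurableFun.Build _ _ _ _ i0 mi0).
pose phi0 : T -> T' * R := fun w => (i0 w, Y w).
have mphi0 : measurable_fun setT phi0.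
  by apply: measurable_fun_pair => //; exact: measurable_funPT.
pose phi : {mfun T >-> (T' * R)%type} :=
  HB.pack phi0 (isMeasurableFun.Build _ _ _ _ phi0 mphi0).
pose f (z : T' * R) := (U z.1 * h z.2)%:E.
have mf : measurable_fun setT f.
  apply/measurable_EFinP; apply: measurable_funM.
    exact: (measurableT_comp mU measurable_fst).
  exact: (measurableT_comp mh measurable_snd).
have f0 z : (0 <= f z)%E by rewrite lee_fin mulr_ge0.
have law X : measurable X ->
    (distribution P i1 \x distribution P Y)%E X = distribution P phi X.
  apply: product_measure_unique => A B sA mB.
  rewrite /distribution /pushforward /=.
  rewrite -(indep_joint_events jJ)//; first by apply: YF; exists B; rewrite ?setTI.
transitivity (\int[distribution P phi]_z f z)%E.
  by rewrite ge0_integral_distribution.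
transitivity (\int[distribution P i1 \x distribution P Y]_z f z)%E.
  by apply: eq_measure_integral => X mX _; apply/esym/law.
rewrite fubini_tonelli1//.
have mhE : measurable_fun setT (EFin \o h) by exact/measurable_EFinP.
transitivity (\int[distribution P i1]_x
    ((U x)%:E * \int[P]_w (h (Y w))%:E))%E.
  apply: eq_integral => x _; rewrite /fubini_F /f/=.
  under eq_integral do rewrite EFinM.
  rewrite ge0_integralZl//; last 2 first.
  - by move=> y _; rewrite lee_fin.
  - by rewrite lee_fin.
  by rewrite (@ge0_integral_distribution _ _ _ _ _ P Y (EFin \o h))// => y;
    rewrite lee_fin.
have Ih : (0 <= \int[P]_w (h (Y w))%:E)%E.
  by apply: integral_ge0 => w _; rewrite lee_fin.
rewrite (@ge0_integral_distribution _ _ _ _ _ P i1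
  (fun x => (U x)%:E * \int[P]_w (h (Y w))%:E)%E).
- rewrite /= ge0_integralZr//.
  + by apply/measurable_EFinP; exact: (measurableT_comp mU mi0).
  + by move=> w _; rewrite lee_fin.
- by apply: emeasurable_funM => //; exact/measurable_EFinP.
- by move=> x; rewrite mule_ge0// lee_fin.
Qed.

End independence.

(** * Expectations of nonnegative variables *)

Section ge0_expectation.
Context {disp : measure_display} {T : measurableType disp} {R : realType}.
Variable P : probability T R.
Implicit Types X Y : T -> R.
Local Notation EX X := (\int[P]_w (X w)%:E)%E.

Lemma EX_ge0 X : (forall w, 0 <= X w) -> (0 <= EX X)%E.
Proof. by move=> X0; apply: integral_ge0 => w _; rewrite lee_fin. Qed.

Lemma EX_le X Y : measurable_fun setT X -> measurable_fun setT Y ->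
  (forall w, 0 <= X w) -> (forall w, X w <= Y w) -> (EX X <= EX Y)%E.
Proof.
move=> mX mY X0 XY; apply: ge0_le_integral => //.
- by move=> w _; rewrite lee_fin.
- exact/measurable_EFinP.
- exact/measurable_EFinP.
- by move=> w _; rewrite lee_fin.
Qed.

Lemma EX_cst (c : R) : EX (fun=> c) = c%:E.
Proof. by rewrite integral_cst//= probability_setT mule1. Qed.

Lemma EX_D X Y : measurable_fun setT X -> measurable_fun setT Y ->
  (forall w, 0 <= X w) -> (forall w, 0 <= Y w) ->
  EX (fun w => X w + Y w) = (EX X + EX Y)%E.
Proof.
move=> mX mY X0 Y0; under eq_integral do rewrite EFinD.
apply: ge0_integralD => //.
- by move=> w _; rewrite lee_fin.
- exact/measurable_EFinP.
- by move=> w _; rewrite lee_fin.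
- exact/measurable_EFinP.
Qed.

Lemma EX_Zl (c : R) X : measurable_fun setT X -> 0 <= c ->
  (forall w, 0 <= X w) -> EX (fun w => c * X w) = (c%:E * EX X)%E.
Proof.
move=> mX c0 X0; under eq_integral do rewrite EFinM.
apply: ge0_integralZl_EFin => //; first by move=> w _; rewrite lee_fin.
exact/measurable_EFinP.
Qed.

Lemma EX_sum (I : Type) (r : seq I) (X : I -> T -> R) :
  (forall i, measurable_fun setT (X i)) -> (forall i w, 0 <= X i w) ->
  EX (fun w => \sum_(i <- r) X i w) = (\sum_(i <- r) EX (X i))%E.
Proof.
move=> mX X0; under eq_integral do rewrite -sumEFin.
apply: ge0_integral_sum => //.
- by move=> i; exact/measurable_EFinP.
- by move=> i w _; rewrite lee_fin.
Qed.

Lemma EX_gt0 X : measurable_fun setT X -> (forall w, 0 < X w) -> (0 < EX X)%E.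
Proof.
move=> mX X0; rewrite lt_neqAle EX_ge0 ?andbT; last by move=> w; exact: ltW.
apply/eqP => /esym I0.
have mXE : measurable_fun setT (EFin \o X) by exact/measurable_EFinP.
have : (\int[P]_w `|(EFin \o X) w| = 0)%E.
  by rewrite -[RHS]I0; apply: eq_integral => w _ /=; rewrite ger0_norm ?ltW.
move=> /(ae_eq_integral_abs P measurableT mXE) [A [mA PA XA]].
have : (P setT <= P A)%E.
  apply: le_measure; rewrite ?inE// => w _; apply: XA => /= /(_ I) [] X_0.
  by have := X0 w; rewrite X_0 ltxx.
by rewrite probability_setT PA lee_fin ler10.
Qed.

(* [2 t V <= t ^ 2 + V ^ 2] for every [t > s], then [t] tends to [s]; this
   avoids dividing by a second moment that may vanish. *)
Lemma EX_weighted_le (N : nat) (W V : 'I_N -> T -> R) (e s : R) :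
  (forall i, measurable_fun setT (W i)) -> (forall i, measurable_fun setT (V i)) ->
  (forall i w, 0 <= W i w <= e) -> (forall i w, 0 <= V i w) -> 0 <= e -> 0 <= s ->
  (EX (fun w => N%:R^-1 * \sum_i W i w * V i w ^+ 2) <= (e * s ^+ 2)%:E)%E ->
  (EX (fun w => N%:R^-1 * \sum_i W i w * V i w) <= (e * s)%:E)%E.
Proof.
move=> mW mV We V0 e0 s0 WV2.
have W0 i w : 0 <= W i w by have /andP[] := We i w.
pose Y w := N%:R^-1 * \sum_i W i w * V i w.
pose Z w := N%:R^-1 * \sum_i W i w * V i w ^+ 2.
have mY : measurable_fun setT Y.
  apply: measurable_funM => //; apply: measurable_sum => i.
  exact: measurable_funM.
have mZ : measurable_fun setT Z.
  apply: measurable_funM => //; apply: measurable_sum => i.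
  by apply: measurable_funM => //; exact: measurable_funX.
have Y0 w : 0 <= Y w.
  by rewrite mulr_ge0// sumr_ge0// => i _; rewrite mulr_ge0.
have Z0 w : 0 <= Z w.
  by rewrite mulr_ge0// sumr_ge0// => i _; rewrite mulr_ge0// sqr_ge0.
have key t : s < t -> (EX Y <= (e * t)%:E)%E.
  move=> st; have t0 : 0 < t by exact: le_lt_trans st.
  have : ((2 * t)%:E * EX Y <= (2 * e * t ^+ 2)%:E)%E.
    rewrite -EX_Zl ?mulr_ge0 ?(ltW t0)//.
    apply: (@le_trans _ _ (EX (fun w => e * t ^+ 2 + Z w))).
      apply: EX_le => //.
      - exact: measurable_funM.
      - exact: measurable_funD.
      - by move=> w; rewrite mulr_ge0 ?Y0// mulr_ge0// ltW.
      move=> w; rewrite /Y /Z.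
      apply: (@le_trans _ _ (N%:R^-1 * \sum_(i < N) (e * t ^+ 2)
          + N%:R^-1 * \sum_i W i w * V i w ^+ 2)); last first.
        rewrite lerD2r sumr_const card_ord -[X in _ * X]mulr_natl.
        have [->|N0] := eqVneq (N%:R : R) 0.
          by rewrite invr0 !mul0r mulr_ge0// sqr_ge0.
        by rewrite mulKf.
      rewrite -mulrDr mulrCA ler_wpM2l// mulr_sumr -big_split/=.
      apply: ler_sum => i _.
      apply: (@le_trans _ _ (W i w * (t ^+ 2 + V i w ^+ 2))).
        rewrite mulrCA ler_wpM2l//.
        by have := sqr_ge0 (t - V i w); lra.
      by rewrite mulrDr lerD2r ler_wpM2r ?sqr_ge0//; have /andP[] := We i w.
    rewrite EX_D//; last by move=> w; rewrite mulr_ge0// sqr_ge0.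
    rewrite EX_cst; apply: (le_trans (leeD2l _ WV2)).
    rewrite -EFinD lee_fin.
    have : s ^+ 2 <= t ^+ 2 by rewrite ler_pXn2r ?nnegrE// ltW.
    move=> /(ler_wpM2l e0); lra.
  have -> : ((2 * e * t ^+ 2)%:E = (2 * t)%:E * (e * t)%:E)%E.
    by rewrite -EFinM; congr EFin; ring.
  by rewrite lee_pmul2l// lte_fin mulr_gt0.
move: key; have := EX_ge0 Y0; case: (EX Y) => [y| |].
- move=> _ key; rewrite lee_fin; apply/ler_addgt0Pl => r r0.
  have e10 : 0 < e + 1 by rewrite ltr_wpDl.
  have := key (s + r / (e + 1)); rewrite ltrDl divr_gt0// lee_fin.
  move=> /(_ isT) H; apply: (le_trans H).
  rewrite mulrDr addrC lerD2r mulrCA ger_pMr// ler_pdivrMr// mul1r.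
  by rewrite lerDl.
- by move=> _ /(_ (s + 1)); rewrite ltrDl ltr01 => /(_ isT); rewrite leye_eq.
- by [].
Qed.

Lemma EX_sqr_dev X : measurable_fun setT X ->
  (EX (fun w => X w ^+ 2) < +oo)%E ->
  (EX (fun w => (X w - fine 'E_P[X]) ^+ 2) + (fine 'E_P[X] ^+ 2)%:E =
   EX (fun w => X w ^+ 2))%E.
Proof.
move=> mX X2.
have mX2 : measurable_fun setT (fun w => (X w ^+ 2)%:E).
  by apply/measurable_EFinP; exact: measurable_funX.
have iX2 : P.-integrable setT (fun w => (X w ^+ 2)%:E).
  apply/integrableP; split => //.
  by under eq_integral do rewrite /= ger0_norm ?sqr_ge0//.
have i1 c : P.-integrable setT (fun=> c%:E).
  apply/integrableP; split; first exact: measurable_cst.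
  by rewrite integral_cst//= probability_setT mule1 ltry.
(* From |X| <= X^2 + 1, a constant being integrable for a probability. *)
have iX : P.-integrable setT (fun w => (X w)%:E).
  have : P.-integrable setT (fun w => ((X w ^+ 2)%:E + 1%:E)%E).
    exact: integrableD.
  apply: le_integrable => //; first exact/measurable_EFinP.
  move=> w _ /=; rewrite lee_fin [leRHS]ger0_norm ?addr_ge0 ?sqr_ge0//.
  rewrite ler_norml; apply/andP; split.
    by have := sqr_ge0 (X w + 1 / 2); lra.
  by have := sqr_ge0 (X w - 1 / 2); lra.
have EXE : ('E_P[X] = EX X)%E by rewrite unlock.
have fE : EX X \is a fin_num by exact: integrable_fin_num.
set c := fine _; have cE : EX X = c%:E by rewrite /c EXE fineK.
have -> : EX (fun w => (X w - c) ^+ 2) =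
    (\int[P]_w ((X w ^+ 2)%:E + ((- (2 * c))%:E * (X w)%:E + (c ^+ 2)%:E)))%E.
  by apply: eq_integral => w _; rewrite -EFinM -!EFinD; congr EFin; ring.
have iZ : P.-integrable setT (fun w => ((- (2 * c))%:E * (X w)%:E)%E).
  exact: integrableZl.
rewrite integralD//; last exact: integrableD.
rewrite integralD// integralZl// integral_cst//= probability_setT mule1.
rewrite cE -addeA -[RHS]adde0; congr (_ + _)%E.
by rewrite -EFinM -!EFinD; congr EFin; ring.
Qed.

End ge0_expectation.

(** * The ESCBO iteration in expectation *)

Section escbo_expectation.
Context {R : realType} {d N : nat} {disp : measure_display}
  {T : measurableType disp}.
Variables (P : probability T R) (f : 'rV[R]_d -> R) (Lf : R)
  (beta lambda delta sigma Mg Lg fs v : R) (alpha : R^nat)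
  (x0 : 'I_N -> {RV P >-> rVborel R d}) (eta : nat -> 'I_d -> {RV P >-> R})
  (c0 : 'rV[R]_d).
Hypotheses (N_gt0 : (0 < N)%N) (Lf_gt0 : 0 < Lf) (f_lip : elipschitz Lf f)
  (f_ge : forall x, fs <= f x)
  (beta_gt0 : 0 < beta) (lambda_gt0 : 0 < lambda) (delta_ge0 : 0 <= delta)
  (alpha_ge0 : forall k, 0 <= alpha k) (Mg_gt0 : 0 < Mg) (Lg_gt0 : 0 < Lg).
Hypothesis g_bound : forall x, enorm (fd_grad f sigma x) <= Mg.
Hypothesis g_lip : forall x y,
  enorm (fd_grad f sigma x - fd_grad f sigma y) <= Lg * enorm (x - y).
Hypothesis eta_law : forall k l B, measurable B ->
  distribution P (eta k l) B = gaussian_law 0 delta B.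

Local Notation EX X := (\int[P]_w (X w)%:E)%E.

Definition escbo_events (j : 'I_N + nat * 'I_d) : set (set T) :=
  match j with
  | inl i => sigma_of (x0 i)
  | inr kl => sigma_of (eta kl.1 kl.2)
  end.

Hypothesis indep : mutually_independent P escbo_events.
Hypothesis x0_spread : forall i,
  (EX (fun w => enorm ((x0 i w : 'rV[R]_d) - c0) ^+ 2) <= v%:E)%E.
Hypothesis v_ge0 : 0 <= v.

(** Indices of the variables that determine the iterate k: all initial data and the noise of steps 0
    to k - 1. Step k itself is excluded, so its noise is fresh. *)
Definition escbo_past k : seq ('I_N + nat * 'I_d) :=
  map inl (enum 'I_N) ++ map inr [seq (m, l) | m <- iota 0 k, l <- enum 'I_d].

Local Notation particles k w :=
  (escbo f beta lambda sigma alpha (fun j => x0 j w : 'rV[R]_d)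
    (fun n => \row_l eta n l w) k).
Local Notation past k :=
  (g_sigma_algebraType (joint_events escbo_events (escbo_past k))).

Lemma sigma_of_comp {disp' : measure_display} {T' : measurableType disp'}
    (Y : {RV P >-> T'}) (g : T' -> R) (B : set R) :
  measurable_fun setT g -> measurable B -> sigma_of Y ((fun w => g (Y w)) @^-1` B).
Proof.
move=> mg mB; exists (g @^-1` B); last by rewrite setTI.
by rewrite -[Z in measurable Z]setTI; exact: mg.
Qed.

Lemma escbo_events_measurable j A : escbo_events j A -> measurable A.
Proof.
case: j => [i|[k l]] /= [B mB <-]; first exact: (measurable_funPT (x0 i)).
exact: (measurable_funPT (eta k l)).
Qed.

Lemma escbo_events_setT j : escbo_events j setT.
Proof. by case: j => [i|[k l]]; exists setT; rewrite ?preimage_setT ?setTI. Qed.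

Lemma escbo_events_setI j : setI_closed (escbo_events j).
Proof.
case: j => [i|[k l]] A B [A' mA <-] [B' mB <-]; exists (A' `&` B');
  by [exact: measurableI|rewrite !setTI preimage_setI].
Qed.

Lemma escbo_past_uniq k l : uniq (inr (k, l) :: escbo_past k).
Proof.
rewrite /escbo_past /= mem_cat negb_or; apply/andP; split.
  apply/andP; split; first by apply/mapP => -[].
  apply/mapP => -[_ /allpairsP[[m j] [mk _ ->]] [km _]].
  by move: mk; rewrite /= -km mem_iota ltnn.
rewrite cat_uniq; apply/and3P; split.
- by rewrite map_inj_uniq ?enum_uniq// => ? ? [].
- by apply/hasPn => _ /mapP[x _ ->]; apply/mapP => -[].
- rewrite map_inj_uniq; last by move=> ? ? [].
  by rewrite allpairs_uniq ?enum_uniq ?iota_uniq// => -[? ?] [].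
Qed.

Lemma measurable_escbo_past k i l :
  measurable_fun setT ((fun w => particles k w i 0 l) : past k -> R).
Proof.
have sub j (A : set T) : j \in escbo_past k -> escbo_events j A ->
    measurable (A : set (past k)).
  by move=> jk Aj; apply: sub_sigma_algebra;
    exact: (joint_events_sub escbo_events_setT jk).
apply: (@measurable_escbo R d N _ (past k) f Lf f_lip beta lambda sigma alpha
  (fun w j => x0 j w) (fun w k => \row_l eta k l w)) => [j m|j jk m].
  move=> _ B mB; rewrite setTI; apply: (sub (inl j)).
    by rewrite mem_cat map_f// mem_enum.
  exact: (@sigma_of_comp _ _ (x0 j) _ B (rVborel_coord_measurable m) mB).
under eq_fun do rewrite mxE.
move=> _ B mB; rewrite setTI; apply: (sub (inr (j, m))).
  rewrite mem_cat map_f ?orbT//; apply/allpairsP; exists (j, m).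
  by rewrite mem_iota mem_enum.
exact: (@sigma_of_comp _ _ (eta j m) id).
Qed.

Lemma past_measurable k (U : T -> R) :
  measurable_fun setT (U : past k -> R) -> measurable_fun setT U.
Proof.
move=> mU _ B mB; have := mU measurableT B mB; rewrite !setTI.
apply: smallest_sub; first exact: sigma_algebra_measurable.
exact: joint_events_measurable escbo_events_measurable _.
Qed.

(** Serves twice: with c = 1 - lambda for the contraction of the spread, and with c = 0 for the size
    of the noise displacement. *)
Lemma escbo_noise_le k l (c : R) (U : T -> R) :
  measurable_fun setT (U : past k -> R) -> (forall w, 0 <= U w) ->
  (EX (fun w => (U w * (c - eta k l w) ^+ 2)%R) <=
   (c ^+ 2 + delta ^+ 2)%:E * EX U)%E.
Proof.
move=> mU U0.
rewrite (expectation_indepM escbo_events_measurable escbo_events_setT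
  escbo_events_setI indep (escbo_past_uniq k l) (Y := eta k l)
  (h := fun y => (c - y) ^+ 2))//.
- by rewrite muleC lee_wpmul2r ?EX_ge0// gaussian_sqr_le// => B; exact: eta_law.
- by apply: measurable_funX; exact: measurable_funB.
- by move=> y; exact: sqr_ge0.
Qed.

Definition spread k w :=
  N%:R^-1 ^+ 2 *
    \sum_i \sum_j enorm (particles k w i - particles k w j) ^+ 2.

(** Each coordinate of the spread is multiplied by its own noise component, so the noise is averaged
    out one coordinate at a time. *)
Definition spread_coord k l w :=
  N%:R^-1 ^+ 2 * \sum_i \sum_j (particles k w i - particles k w j) 0 l ^+ 2.

Lemma spreadE k w : spread k w = \sum_l spread_coord k l w.
Proof.
rewrite /spread_coord -mulr_sumr exchange_big/=; congr (_ * _).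
apply: eq_bigr => i _; rewrite exchange_big/=; apply: eq_bigr => j _.
exact: enorm_sqr.
Qed.

Lemma spread_coord_ge0 k l w : 0 <= spread_coord k l w.
Proof.
rewrite mulr_ge0 ?sqr_ge0// sumr_ge0// => i _; rewrite sumr_ge0// => j _.
exact: sqr_ge0.
Qed.

Lemma measurable_spread_coord k l :
  measurable_fun setT (spread_coord k l : past k -> R).
Proof.
apply: measurable_funM => //; apply: measurable_sum => i.
apply: measurable_sum => j; apply: measurable_funX.
rewrite (_ : (fun w => _) = (fun w => particles k w i 0 l - particles k w j 0 l)); last first.
  by apply/funext => w; rewrite !mxE.
by apply: measurable_funB; exact: measurable_escbo_past.
Qed.

Lemma spread_ge0 k w : 0 <= spread k w.
Proof. by rewrite spreadE sumr_ge0// => l _; exact: spread_coord_ge0. Qed.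

Lemma measurable_spread k : measurable_fun setT (spread k : past k -> R).
Proof.
have -> : spread k = fun w => \sum_l spread_coord k l w.
  by apply/funext => w; exact: spreadE.
apply: measurable_sum => l.
exact: measurable_spread_coord.
Qed.

Lemma spread_step k w : spread k.+1 w <=
  2 * (\sum_l spread_coord k l w * (1 - lambda - eta k l w) ^+ 2)
  + 2 * (alpha k ^+ 2 * Lg ^+ 2) * spread k w.
Proof.
have -> : 2 * (\sum_l spread_coord k l w * (1 - lambda - eta k l w) ^+ 2) =
   N%:R^-1 ^+ 2 * \sum_i \sum_j (2 * \sum_(l < d)
     (particles k w i - particles k w j) 0 l ^+ 2 *
        (1 - lambda - (\row_l eta k l w) 0 l) ^+ 2).
  rewrite mulr_sumr.
  under [in RHS]eq_bigr do under eq_bigr do rewrite mulr_sumr.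
  under [in RHS]eq_bigr do rewrite exchange_big/=.
  rewrite [in RHS]exchange_big/= mulr_sumr; apply: eq_bigr => l _.
  have mulrACC (q t c : R) : 2 * (q * t * c) = q * (t * (2 * c)) by ring.
  rewrite /spread_coord mulrACC; congr (_ * _).
  rewrite mulr_suml; apply: eq_bigr => i _; rewrite mulr_suml.
  have rowE : (\row_l eta k l w) 0 l = eta k l w by rewrite mxE.
  by apply: eq_bigr => j _; rewrite rowE [in RHS]mulrCA.
rewrite /spread mulrCA -mulrDr ler_wpM2l ?sqr_ge0//.
rewrite mulr_sumr -big_split/=; apply: ler_sum => i _.
rewrite mulr_sumr -big_split/=; apply: ler_sum => j _.
by rewrite [Z in _ + _ * Z]enorm_sqr; apply: escbo_step_dist => //; exact: ltW.
Qed.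

Lemma EX_spread_step k :
  (EX (spread k.+1) <= (C1 lambda delta Lg alpha k)%:E * EX (spread k))%E.
Proof.
have mS l : measurable_fun setT (spread_coord k l).
  exact: past_measurable (@measurable_spread_coord k l).
have S0 l w := spread_coord_ge0 k l w.
have mD j : measurable_fun setT (spread j).
  exact: past_measurable (@measurable_spread j).
have mh l : measurable_fun setT
    (fun w => spread_coord k l w * (1 - lambda - eta k l w) ^+ 2).
  apply: measurable_funM => //; apply: measurable_funX.
  exact: measurable_funB.
have h0 l w : 0 <= spread_coord k l w * (1 - lambda - eta k l w) ^+ 2.
  by rewrite mulr_ge0// sqr_ge0.
have mA : measurable_fun setT (fun w =>
    \sum_l spread_coord k l w * (1 - lambda - eta k l w) ^+ 2).
  exact: measurable_sum.
have A0 w : 0 <= \sum_l spread_coord k l w * (1 - lambda - eta k l w) ^+ 2.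
  by rewrite sumr_ge0.
have aL0 : 0 <= 2 * (alpha k ^+ 2 * Lg ^+ 2) by rewrite mulr_ge0// mulr_ge0 ?sqr_ge0.
apply: (@le_trans _ _ (EX (fun w =>
    2 * (\sum_l spread_coord k l w * (1 - lambda - eta k l w) ^+ 2)
  + 2 * (alpha k ^+ 2 * Lg ^+ 2) * spread k w))).
  apply: EX_le => //.
  - by apply: measurable_funD; apply: measurable_funM.
  - exact: spread_ge0.
  - exact: spread_step.
rewrite EX_D//; last 4 first.
- exact: measurable_funM.
- exact: measurable_funM.
- by move=> w; rewrite mulr_ge0.
- by move=> w; rewrite mulr_ge0// spread_ge0.
rewrite (EX_Zl P mA)// EX_sum// (EX_Zl P (mD k))//; last exact: spread_ge0.
have -> : C1 lambda delta Lg alpha k =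
  2 * ((1 - lambda) ^+ 2 + delta ^+ 2) + 2 * (alpha k ^+ 2 * Lg ^+ 2).
  by rewrite /C1; ring.
have c0' : 0 <= (1 - lambda) ^+ 2 + delta ^+ 2 by rewrite addr_ge0 ?sqr_ge0.
rewrite [Z in (_ <= Z * _)%E]EFinD ge0_muleDl ?lee_fin ?mulr_ge0 ?(ltW Lg_gt0)//.
rewrite leeD2r// [Z in (_ <= Z * _)%E]EFinM -muleA lee_wpmul2l//.
have -> : EX (spread k) = (\sum_l EX (spread_coord k l))%E.
  by under eq_integral do rewrite spreadE; rewrite EX_sum.
rewrite ge0_sume_distrr; last by move=> l _; exact: EX_ge0.
apply: lee_sum => l _; apply: escbo_noise_le => //.
exact: measurable_spread_coord.
Qed.

(** [c0] stands for the mean of the initial law and [v] for its variance. The N^2 of the double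
    average meets the 2 N of [sum_sqr_dist_le], leaving twice the average of |x^i - c0|^2. *)
Lemma EX_spread0 : (EX (spread 0) <= (2 * v)%:E)%E.
Proof.
have md i : measurable_fun setT
    (fun w => enorm ((x0 i w : 'rV[R]_d) - c0) ^+ 2).
  apply: measurable_funX; apply: measurable_enorm => l.
  under eq_fun do rewrite !mxE.
  apply: measurable_funB => //.
  by apply: (measurableT_comp (rVborel_coord_measurable l)).
have Np : 0 < N%:R :> R by rewrite ltr0n.
apply: (@le_trans _ _ (EX (fun w => 2 * N%:R^-1 *
    \sum_i enorm ((x0 i w : 'rV[R]_d) - c0) ^+ 2))).
  apply: EX_le.
  - exact: past_measurable (@measurable_spread 0).
  - by apply: measurable_funM => //; exact: measurable_sum.
  - exact: spread_ge0.
  move=> w; rewrite /spread /=.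
  apply: (le_trans (ler_wpM2l _ (sum_sqr_dist_le _ c0))); first exact: sqr_ge0.
  have NE : N%:R^-1 ^+ 2 * (2 * N%:R) = 2 * N%:R^-1 :> R.
    by field; rewrite gt_eqF.
  by rewrite mulrA NE.
rewrite EX_Zl ?mulr_ge0//; last 2 first.
- exact: measurable_sum.
- by move=> w; rewrite sumr_ge0// => i _; exact: sqr_ge0.
rewrite EX_sum//; last by move=> i w; exact: sqr_ge0.
apply: (@le_trans _ _ ((2 * N%:R^-1)%:E * \sum_(i < N) v%:E)%E).
  by rewrite lee_wpmul2l ?lee_fin ?mulr_ge0//; exact: lee_sum.
rewrite sumEFin -EFinM lee_fin sumr_const card_ord -[X in _ * X]mulr_natl.
by rewrite mulrA divfK// gt_eqF.
Qed.

(** The expression under the square root in [C3], with [v] for the variance. *)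
Definition spread_bound k := 2 * \prod_(0 <= m < k) C1 lambda delta Lg alpha m * v.

Lemma C1_ge0 k : 0 <= C1 lambda delta Lg alpha k.
Proof.
by rewrite mulr_ge0// addr_ge0 ?addr_ge0 ?sqr_ge0// mulr_ge0 ?sqr_ge0.
Qed.

Lemma spread_bound_ge0 k : 0 <= spread_bound k.
Proof. by rewrite !mulr_ge0// prodr_ge0// => m _; exact: C1_ge0. Qed.

Lemma EX_spread_le k : (EX (spread k) <= (spread_bound k)%:E)%E.
Proof.
elim: k => [|k IH]; first by rewrite /spread_bound big_nil mulr1 EX_spread0.
apply: (le_trans (EX_spread_step k)).
apply: (@le_trans _ _ ((C1 lambda delta Lg alpha k)%:E * (spread_bound k)%:E)%E).
  by rewrite lee_wpmul2l ?lee_fin ?C1_ge0.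
rewrite -EFinM lee_fin /spread_bound big_nat_recr//=.
by rewrite le_eqVlt; apply/orP; left; apply/eqP; ring.
Qed.

Local Notation e := (expR (- beta * fs)).

Definition weight k i w := expR (- beta * f (particles k w i)).

Definition deviation k i w := particles k w i - consensus f beta (particles k w).

(** The quantity followed through the iteration: its expectation at k = 0 is the Laplace functional
    of the initial law, and its almost sure limit is the weight of x_infty. *)
Definition mean_weight k w := N%:R^-1 * \sum_i weight k i w.

Lemma weight_bounds k i w : 0 <= weight k i w <= e.
Proof. by rewrite expR_ge0 ler_expR !mulNr lerN2 ler_wpM2l// ltW. Qed.

Lemma measurable_weight k i : measurable_fun setT (weight k i : past k -> R).
Proof.
by apply: (measurable_laplace_weight f_lip) => l; exact: measurable_escbo_past.
Qed.

Lemma measurable_deviation k i l :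
  measurable_fun setT ((fun w => deviation k i w 0 l) : past k -> R).
Proof.
rewrite (_ : (fun w => _) = fun w => particles k w i 0 l -
    consensus f beta (particles k w) 0 l); last first.
  by apply/funext => w; rewrite /deviation; move: (consensus _ _ _) => c; rewrite !mxE.
apply: measurable_funB; first exact: measurable_escbo_past.
by apply: (measurable_consensus f_lip) => j m; exact: measurable_escbo_past.
Qed.

Lemma measurable_noise k i : measurable_fun setT
  (fun w => enorm (hadamard (deviation k i w) (\row_l eta k l w))).
Proof.
apply: measurable_enorm => l.
rewrite (_ : (fun w => _) = fun w => deviation k i w 0 l * eta k l w).
  by apply: measurable_funM => //; exact: past_measurable (@measurable_deviation k i l).
by apply/funext => w; move: (deviation k i w) => u; rewrite !mxE.
Qed.

Lemma measurable_mean_weight k : measurable_fun setT (mean_weight k).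
Proof.
apply: measurable_funM => //; apply: measurable_sum => i.
exact: past_measurable (@measurable_weight k i).
Qed.

Lemma mean_weight_bounds k w : 0 <= mean_weight k w <= e.
Proof.
have we i := weight_bounds k i w.
have Np : 0 < N%:R :> R by rewrite ltr0n.
rewrite mulr_ge0 ?sumr_ge0//=; last by move=> i _; case/andP: (we i).
rewrite ler_pdivrMl// mulr_natl -[X in _ *+ X]card_ord -sumr_const.
by apply: ler_sum => i _; case/andP: (we i).
Qed.

Lemma EX_deviation_sqr k :
  (EX (fun w => (N%:R^-1 * \sum_i weight k i w * enorm (deviation k i w) ^+ 2)%R)
   <= (e * spread_bound k)%:E)%E.
Proof.
have mu i l := past_measurable (@measurable_deviation k i l).
have mw i := past_measurable (@measurable_weight k i).
have mS := past_measurable (@measurable_spread k).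
rewrite EFinM; apply: (@le_trans _ _ (e%:E * EX (spread k))%E); last first.
  by rewrite lee_wpmul2l ?lee_fin ?expR_ge0//; exact: EX_spread_le.
rewrite -EX_Zl ?expR_ge0//; last exact: spread_ge0.
apply: EX_le.
- apply: measurable_funM => //; apply: measurable_sum => i.
  by apply: measurable_funM => //; apply: measurable_funX; exact: measurable_enorm.
- exact: measurable_funM.
- move=> w; rewrite mulr_ge0// sumr_ge0// => i _.
  by rewrite mulr_ge0 ?sqr_ge0 ?expR_ge0.
- by move=> w; apply: consensus_spread_le => //; exact: ltW.
Qed.

(** The factor [e] stands outside the root because the weights supply it twice: sqrt e from the
    total weight, sqrt e from the weighted second moment. *)
Lemma EX_deviation k :
  (EX (fun w => (N%:R^-1 * \sum_i weight k i w * enorm (deviation k i w))%R)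
   <= (e * Num.sqrt (spread_bound k))%:E)%E.
Proof.
have mu i l := past_measurable (@measurable_deviation k i l).
apply: EX_weighted_le => //.
- by move=> i; exact: past_measurable (@measurable_weight k i).
- by move=> i; exact: measurable_enorm.
- exact: weight_bounds.
- by move=> i w; exact: enorm_ge0.
- by rewrite sqr_sqrtr ?spread_bound_ge0//; exact: EX_deviation_sqr.
Qed.

Lemma EX_noise k :
  (EX (fun w => (N%:R^-1 * \sum_i weight k i w *
     enorm (hadamard (deviation k i w) (\row_l eta k l w)))%R)
   <= (e * (delta * Num.sqrt (spread_bound k)))%:E)%E.
Proof.
have mu i l := past_measurable (@measurable_deviation k i l).
have mw i := past_measurable (@measurable_weight k i).
apply: EX_weighted_le => //.
- by move=> i; exact: measurable_noise.
- exact: weight_bounds.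
- by move=> i w; exact: enorm_ge0.
- by rewrite mulr_ge0.
pose V l w := N%:R^-1 * \sum_i weight k i w * deviation k i w 0 l ^+ 2.
have mV l : measurable_fun setT (V l : past k -> R).
  apply: measurable_funM => //; apply: measurable_sum => i.
  apply: measurable_funM; first exact: measurable_weight.
  by apply: measurable_funX; exact: measurable_deviation.
have V0 l w : 0 <= V l w.
  rewrite mulr_ge0// sumr_ge0// => i _.
  by rewrite mulr_ge0 ?sqr_ge0 ?expR_ge0.
(* Used with r the squared noise, to bring the sum over coordinates outside before averaging, and
   with r = 1, to reassemble the squared deviation afterwards. *)
have swap (r : 'I_d -> T -> R) w : N%:R^-1 * \sum_i weight k i w *
    \sum_l deviation k i w 0 l ^+ 2 * r l w = \sum_l V l w * r l w.
  rewrite /V mulr_sumr.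
  under eq_bigr do rewrite !mulr_sumr.
  rewrite exchange_big/=; apply: eq_bigr => l _.
  rewrite -mulrA mulr_suml mulr_sumr; apply: eq_bigr => i _.
  by rewrite !mulrA.
rewrite [leLHS](_ : _ = EX (fun w => \sum_l V l w * (0 - eta k l w) ^+ 2)); last first.
  apply: eq_integral => w _; rewrite -(swap (fun l w => (0 - eta k l w) ^+ 2)).
  congr (_ * _)%:E; apply: eq_bigr => i _; congr (_ * _).
  rewrite enorm_sqr; apply: eq_bigr => l _.
  by move: (deviation k i w) => u; rewrite !mxE exprMn sub0r sqrrN.
rewrite EX_sum; last 2 first.
- move=> l; apply: measurable_funM; first exact: past_measurable (mV l).
  by apply: measurable_funX; exact: measurable_funB.
- by move=> l w; rewrite mulr_ge0 ?sqr_ge0.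
apply: (@le_trans _ _ (\sum_l ((0 ^+ 2 + delta ^+ 2)%:E * EX (V l)))%E).
  by apply: lee_sum => l _; exact: escbo_noise_le.
rewrite expr0n/= add0r -ge0_sume_distrr; last by move=> l _; exact: EX_ge0.
rewrite -EX_sum//; last by move=> l; exact: past_measurable (mV l).
rewrite exprMn sqr_sqrtr ?spread_bound_ge0// mulrCA [leRHS]EFinM.
rewrite lee_wpmul2l ?lee_fin ?sqr_ge0//.
apply: le_trans (EX_deviation_sqr k).
rewrite le_eqVlt; apply/orP; left; apply/eqP; apply: eq_integral => w _.
congr EFin; under eq_bigr do rewrite -[V _ _]mulr1.
rewrite -(swap (fun _ _ => 1)); congr (_ * _); apply: eq_bigr => i _.
by rewrite enorm_sqr; congr (_ * _); apply: eq_bigr => l _; rewrite mulr1.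
Qed.

Definition drift k := (lambda + delta) * Num.sqrt (spread_bound k) + alpha k * Mg.

(** The displacement splits into drift, noise and gradient. The first two keep their weights and use
    [EX_deviation] and [EX_noise]; the gradient part only needs each weight to be at most [e]. *)
Lemma EX_mean_weight_step k : (EX (mean_weight k) <=
  EX (mean_weight k.+1) + (beta * Lf * e * drift k)%:E)%E.
Proof.
have mu i l := past_measurable (@measurable_deviation k i l).
have mw i := past_measurable (@measurable_weight k i).
pose Y1 w := N%:R^-1 * \sum_i weight k i w * enorm (deviation k i w).
pose Y2 w := N%:R^-1 * \sum_i weight k i w *
  enorm (hadamard (deviation k i w) (\row_l eta k l w)).
have mY1 : measurable_fun setT Y1.
  apply: measurable_funM => //; apply: measurable_sum => i.
  by apply: measurable_funM => //; exact: measurable_enorm.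
have mY2 : measurable_fun setT Y2.
  apply: measurable_funM => //; apply: measurable_sum => i.
  by apply: measurable_funM => //; exact: measurable_noise.
have Y10 w : 0 <= Y1 w.
  by rewrite mulr_ge0// sumr_ge0// => i _; rewrite mulr_ge0 ?expR_ge0 ?enorm_ge0.
have Y20 w : 0 <= Y2 w.
  by rewrite mulr_ge0// sumr_ge0// => i _; rewrite mulr_ge0 ?expR_ge0 ?enorm_ge0.
have bL0 : 0 <= beta * Lf by rewrite mulr_ge0 ?ltW.
have m0 j w : 0 <= mean_weight j w by case/andP: (mean_weight_bounds j w).
have aM0 : 0 <= alpha k * Mg * e by rewrite !mulr_ge0 ?expR_ge0 ?(ltW Mg_gt0).
have l0 := ltW lambda_gt0.
have Np : 0 < N%:R :> R by rewrite ltr0n.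
have pt w : mean_weight k w <= mean_weight k.+1 w +
    beta * Lf * (lambda * Y1 w + Y2 w + alpha k * Mg * e).
  have -> : alpha k * Mg * e = N%:R^-1 * \sum_(i < N) (alpha k * Mg * e).
    by rewrite sumr_const card_ord -(mulr_natl (alpha k * Mg * e)) mulKf// gt_eqF.
  rewrite /mean_weight /Y1 /Y2 mulrCA -!mulrDr mulrCA -mulrDr ler_wpM2l//.
  rewrite !mulr_sumr -!big_split/= mulr_sumr -big_split/=.
  apply: ler_sum => i _.
  apply: (le_trans (laplace_weight_lip _ (particles k.+1 w i) (ltW beta_gt0) f_lip)).
  rewrite lerD2l ler_wpM2l//.
  have /= := escbo_step_sub f beta lambda sigma (alpha k)
    (\row_l eta k l w) (particles k w) i.
  rewrite (ger0_norm l0) (ger0_norm (alpha_ge0 k)) -/(deviation k i w) => D.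
  have /andP[w0 we] := weight_bounds k i w.
  apply: (le_trans (ler_wpM2l w0 D)).
  rewrite !mulrDr mulrCA lerD2l mulrCA -mulrA ler_wpM2l// mulrC ler_pM//.
  exact: enorm_ge0.
apply: (@le_trans _ _ (EX (fun w => mean_weight k.+1 w +
    beta * Lf * (lambda * Y1 w + Y2 w + alpha k * Mg * e)))).
  apply: EX_le => //; first exact: measurable_mean_weight.
  apply: measurable_funD; first exact: measurable_mean_weight.
  apply: measurable_funM => //; apply: measurable_funD => //.
  by apply: measurable_funD => //; exact: measurable_funM.
have mZ1 : measurable_fun setT (fun w => lambda * Y1 w + Y2 w).
  by apply: measurable_funD => //; exact: measurable_funM.
have Z10 w : 0 <= lambda * Y1 w + Y2 w by rewrite addr_ge0// mulr_ge0.
rewrite EX_D//; last 3 first.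
- exact: measurable_mean_weight.
- by apply: measurable_funM => //; exact: measurable_funD.
- by move=> w; rewrite mulr_ge0// addr_ge0.
rewrite leeD2l// EX_Zl//; last 2 first.
- exact: measurable_funD.
- by move=> w; rewrite addr_ge0.
rewrite -[(beta * Lf * e * drift k)]mulrA [leRHS]EFinM lee_wpmul2l//.
rewrite EX_D// EX_D//; last 2 first.
- exact: measurable_funM.
- by move=> w; rewrite mulr_ge0.
rewrite EX_Zl// EX_cst.
have -> : e * drift k = lambda * (e * Num.sqrt (spread_bound k)) +
    e * (delta * Num.sqrt (spread_bound k)) + alpha k * Mg * e.
  by rewrite /drift; ring.
rewrite !EFinD leeD2r// leeD//; last exact: EX_noise.
by rewrite [leRHS]EFinM lee_wpmul2l//; exact: EX_deviation.
Qed.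

Lemma EX_mean_weight_le k : (EX (mean_weight 0) <=
  EX (mean_weight k) + (beta * Lf * e * \sum_(0 <= n < k) drift n)%:E)%E.
Proof.
elim: k => [|k IH]; first by rewrite big_nil mulr0 adde0.
apply: (le_trans IH); rewrite big_nat_recr//= mulrDr EFinD.
rewrite [X in (_ <= _ + X)%E]addeC addeA; apply: leeD2r.
exact: EX_mean_weight_step.
Qed.

End escbo_expectation.

(** * Laplace functional and conclusion *)

Section laplace.
Context {disp : measure_display} {T : measurableType disp} {R : realType}.
Variable P : probability T R.
Local Notation EX X := (\int[P]_w (X w)%:E)%E.

Lemma same_law_EX {disp' : measure_display} {T' : measurableType disp'}
    (Y Z : {RV P >-> T'}) (g : T' -> R) : same_law Y Z ->
  measurable_fun setT g -> (forall x, 0 <= g x) ->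
  EX (fun w => g (Y w)) = EX (fun w => g (Z w)).
Proof.
move=> YZ mg g0.
have mgE : measurable_fun setT (EFin \o g) by exact/measurable_EFinP.
have gE0 x : (0 <= (EFin \o g) x)%E by rewrite lee_fin.
have E (V : {RV P >-> T'}) :
    EX (fun w => g (V w)) = (\int[distribution P V]_x (EFin \o g) x)%E.
  by rewrite ge0_integral_distribution.
by rewrite !E; apply: eq_measure_integral => A mA _; exact: YZ.
Qed.

(** A real y below g almost surely gives r <= exp (- b y), that is y <= - ln r / b. A finite
    essential infimum is itself such a y. *)
Lemma ess_inf_le_laplace (g : T -> R) (b r : R) : measurable_fun setT g ->
  0 < b -> 0 < r -> (r%:E <= EX (fun w => expR (- b * g w)%R))%E ->
  (ess_inf P (fun w => (g w)%:E) <= (- b^-1 * ln r)%:E)%E.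
Proof.
move=> mg b0 r0 rE.
have key (y : R) : (y%:E <= ess_inf P (fun w => (g w)%:E))%E -> y <= - b^-1 * ln r.
  move=> /ess_infP yg.
  have : r <= expR (- b * y).
    rewrite -lee_fin; apply: (le_trans rE).
    rewrite -(EX_cst P (expR (- b * y))); apply: ae_ge0_le_integral => //.
      apply/measurable_EFinP; apply: measurableT_comp => //.
      exact: measurable_funM.
    apply: filterS yg => w; rewrite !lee_fin => yg _.
    by rewrite ler_expR !mulNr lerN2 ler_wpM2l// ltW.
  move=> rb; have : ln r <= - b * y.
    by rewrite -(expRK (- b * y)) ler_ln// posrE expR_gt0.
  move=> H; rewrite mulNr lerNr -(ler_pM2l b0) mulrA mulfV ?gt_eqF// mul1r.
  by rewrite mulrN -mulNr.
move: (ess_inf P (fun w => (g w)%:E)) key => -[x| |] key; last by rewrite leNye.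
  by rewrite lee_fin key.
(* An infinite essential infimum would admit a real y one above the bound. *)
have /key : ((- b^-1 * ln r + 1)%:E <= +oo)%E by rewrite leey.
by rewrite gerDl leNgt ltr01.
Qed.

End laplace.

(** * Variance of a random vector *)

Section random_vector.
Context {disp : measure_display} {T : measurableType disp} {R : realType}
  {d : nat}.
Variables (P : probability T R) (X : {RV P >-> rVborel R d}).
Local Notation EX X := (\int[P]_w (X w)%:E)%E.
Local Notation xvec w := (X w : 'rV[R]_d).

Lemma rV_coord_measurable l : measurable_fun setT (fun w => xvec w 0 l).
Proof. exact: (measurableT_comp (rVborel_coord_measurable l)). Qed.

Lemma variance_rV_lty_moment : (variance_rV P X < +oo)%E ->
  (EX (fun w => (enorm (xvec w) ^+ 2)%R) < +oo)%E.
Proof.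
have E : ('E_P[fun w => (enorm (xvec w) ^+ 2)%R] =
    EX (fun w => (enorm (xvec w) ^+ 2)%R))%E.
  by rewrite unlock.
rewrite /variance_rV E.
move: (EX (fun w => enorm (xvec w) ^+ 2)) => -[x| |] //= _; by rewrite ltry.
Qed.

(** Koenig-Huygens in each coordinate; the finite second moment makes the coordinate means finite,
    so [fine] does not alter them. *)
Lemma variance_rV_dev : (EX (fun w => (enorm (xvec w) ^+ 2)%R) < +oo)%E ->
  (EX (fun w => (enorm (xvec w - \row_l fine 'E_P[fun w => xvec w 0 l]) ^+ 2)%R)
   = variance_rV P X)%E.
Proof.
move=> X2; set c := \row_l _.
have mX := rV_coord_measurable.
have X2l l : (EX (fun w => (xvec w 0 l ^+ 2)%R) < +oo)%E.
  apply: le_lt_trans X2; apply: EX_le.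
  - exact: measurable_funX.
  - by apply: measurable_funX; exact: measurable_enorm.
  - by move=> w; exact: sqr_ge0.
  - move=> w; rewrite enorm_sqr (bigD1 l)//= lerDl sumr_ge0// => j _.
    exact: sqr_ge0.
have mXc l : measurable_fun setT (fun w => (xvec w - c) 0 l).
  rewrite (_ : (fun w => _) = fun w => xvec w 0 l - c 0 l).
    exact: measurable_funB.
  by apply/funext => w; rewrite !mxE.
have E1 : EX (fun w => enorm (xvec w - c) ^+ 2) =
    (\sum_l EX (fun w => ((xvec w 0 l - fine 'E_P[fun w => xvec w 0 l]) ^+ 2)%R))%E.
  under eq_integral do rewrite enorm_sqr.
  rewrite EX_sum; last 2 first.
  - by move=> l; apply: measurable_funX.
  - by move=> l w; exact: sqr_ge0.
  by apply: eq_bigr => l _; apply: eq_integral => w _; rewrite !mxE.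
have E2 : EX (fun w => enorm (xvec w) ^+ 2) =
    (\sum_l EX (fun w => (xvec w 0 l ^+ 2)%R))%E.
  under eq_integral do rewrite enorm_sqr.
  rewrite EX_sum//; last by move=> l w; exact: sqr_ge0.
  by move=> l; exact: measurable_funX.
have E3 : 'E_P[fun w => (enorm (xvec w) ^+ 2)%R]%E =
    (EX (fun w => (enorm (xvec w - c) ^+ 2)%R) + (enorm c ^+ 2)%:E)%E.
  rewrite {1}unlock E2 E1 enorm_sqr -sumEFin -big_split/=; apply: eq_bigr => l _.
  by rewrite -(EX_sqr_dev (mX l) (X2l l)) mxE.
by rewrite /variance_rV E3 -/c addeK.
Qed.

End random_vector.

(** * Laplace's principle *)

Section laplace_principle.
Context {disp : measure_display} {T : measurableType disp} {R : realType}
  {d : nat}.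
Variables (P : probability T R) (X : {RV P >-> rVborel R d}).
Variables (f : 'rV[R]_d -> R) (Lf : R) (xstar : 'rV[R]_d).
Hypothesis f_lip : elipschitz Lf f.
Hypothesis f_min : forall y, f xstar <= f y.

Local Notation EX X := (\int[P]_w (X w)%:E)%E.

Let mX := rV_coord_measurable X.

Lemma laplaceE b :
  laplace P X f b = EX (fun w => expR (- b * f (X w : 'rV[R]_d))).
Proof. by rewrite /laplace unlock. Qed.

Lemma laplace_gt0 b : (0 < laplace P X f b)%E.
Proof.
rewrite laplaceE; apply: EX_gt0 => [|w]; last exact: expR_gt0.
exact: measurable_laplace_weight.
Qed.

Lemma laplace_le b : 0 <= b ->
  (laplace P X f b <= (expR (- b * f xstar))%:E)%E.
Proof.
move=> b0; rewrite laplaceE -(EX_cst P (expR (- b * f xstar))); apply: EX_le => //.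
- exact: measurable_laplace_weight.
- by move=> w; rewrite ler_expR !mulNr lerN2 ler_wpM2l.
Qed.

Lemma laplace_fin_num b : 0 <= b -> laplace P X f b \is a fin_num.
Proof.
move=> b0; rewrite ge0_fin_numE ?(ltW (laplace_gt0 b))//.
by rewrite (le_lt_trans (laplace_le b0))// ltry.
Qed.

Lemma measurable_sublevel r : measurable [set w | f (X w : 'rV[R]_d) < r].
Proof.
rewrite -[X in measurable X]setTI.
rewrite (_ : [set w | _] = (fun w => f (X w : 'rV[R]_d)) @^-1` `]-oo, r[%classic).
  by apply: (measurable_lipschitz_comp f_lip mX) => //; exact: measurable_itv.
by apply/seteqP; split => x /=; rewrite in_itv.
Qed.

Lemma laplace_ge b r : 0 <= b ->
  ((expR (- b * r))%:E * P [set w | (f (X w : 'rV[R]_d) < r)%R] <= laplace P X f b)%E.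
Proof.
move=> b0; set A := [set w | _].
have mA : measurable A by exact: measurable_sublevel.
rewrite laplaceE.
have -> : ((expR (- b * r))%:E * P A = \int[P]_(w in A) (expR (- b * r))%:E)%E.
  by rewrite integral_cst.
apply: (@le_trans _ _ (\int[P]_(w in A) (expR (- b * f (X w : 'rV[R]_d)))%:E)%E).
  apply: ge0_le_integral => //.
  - apply/measurable_EFinP; apply: measurable_funTS.
    exact: measurable_laplace_weight.
  - move=> w; rewrite /A/= => fr; rewrite lee_fin ler_expR !mulNr lerN2.
    by rewrite ler_wpM2l// ltW.
apply: ge0_subset_integral => //.
- by apply/measurable_EFinP; exact: measurable_laplace_weight.
Qed.

(** The support condition gives the sublevel set {f < r} positive mass p, so the functional lies
    between p exp (- b r) and its value at the minimum of f. Hence b times the error lies between 0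
    and b (e / 3) - ln p - ln eps. *)
Lemma error_cvg0 (eps : R) : 0 < eps -> eps < 1 ->
  support_rV (distribution P X) xstar ->
  error P X f (f xstar) eps b @[b --> +oo] --> 0.
Proof.
move=> eps0 eps1 supp; apply/cvgrPdist_le => e e0.
have e30 : 0 < e / 3 by rewrite divr_gt0.
(* Three thirds of e: the height of the level, - ln p / b and - ln eps / b. *)
set r := f xstar + e / 3.
pose p := fine (P [set w | f (X w : 'rV[R]_d) < r]).
have p0 : 0 < p.
  rewrite fine_gt0//; apply/andP; split; last first.
    by rewrite ltey_eq fin_num_measure//; exact: measurable_sublevel.
  apply: (supp [set x | f x < r]) => /=; last by rewrite /r ltrDl.
  rewrite (_ : [set x | f x < r] = f @^-1` `]-oo, r[%classic); last first.
    by apply/seteqP; split => x /=; rewrite in_itv.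
  have /continuousP := elipschitz_continuous f_lip; apply.
  exact: interval_open.
have p1 : p <= 1.
  by rewrite -lee_fin fineK ?fin_num_measure ?probability_le1//;
    exact: measurable_sublevel.
have lp := ln_le0 p1; have le := ln_le0 (ltW eps1).
near=> b.
have b0 : 0 < b by near: b; exact: nbhs_pinfty_gt.
have bp : - ln p <= b * (e / 3).
  rewrite -ler_pdivrMr//; near: b; exact: nbhs_pinfty_ge.
have be : - ln eps <= b * (e / 3).
  rewrite -ler_pdivrMr//; near: b; exact: nbhs_pinfty_ge.
have Lfin := laplace_fin_num (ltW b0).
have L0 : 0 < fine (laplace P X f b).
  by rewrite fine_gt0// laplace_gt0/= -ge0_fin_numE// ltW// laplace_gt0.
have Lu : ln (fine (laplace P X f b)) <= - b * f xstar.
  rewrite -(expRK (- b * f xstar)) ler_ln ?posrE ?expR_gt0// -lee_fin fineK//.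
  exact: laplace_le (ltW b0).
have Ll : - b * r + ln p <= ln (fine (laplace P X f b)).
  rewrite -(expRK (- b * r)) -lnM ?posrE ?expR_gt0// ler_ln ?posrE
    ?mulr_gt0 ?expR_gt0//.
  rewrite -lee_fin fineK// EFinM fineK ?fin_num_measure//;
    last exact: measurable_sublevel.
  exact: laplace_ge (ltW b0).
have -> : error P X f (f xstar) eps b =
    b^-1 * (- ln (fine (laplace P X f b)) - b * f xstar - ln eps).
  by rewrite /error; field; rewrite gt_eqF.
rewrite sub0r normrN normrM ger0_norm ?invr_ge0 ?(ltW b0)// ler_pdivrMl//.
move: Ll; rewrite /r => Ll; rewrite ger0_norm; lra.
Unshelve. all: by end_near. Qed.

End laplace_principle.

Theorem theorem5p1 (R : realType) (d N : nat)
  (disp : measure_display) (T : measurableType disp) (P : probability T R)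
  (f : 'rV[R]_d -> R) (Lf : R) (xstar : 'rV[R]_d)
  (beta lambda delta sigma eps Mg Lg : R) (alpha : R^nat)
  (xin : {RV P >-> rVborel R d})
  (x0 : 'I_N -> {RV P >-> rVborel R d})
  (eta : nat -> 'I_d -> {RV P >-> R})
  (xinf : {RV P >-> rVborel R d})
  (hd : (0 < d)%N) (hN : (0 < N)%N)
  (f_ge0 : forall x, 0 <= f x)
  (Lf_gt0 : 0 < Lf) (f_lip : elipschitz Lf f)
  (f_min : unique_global_minimizer f xstar)
  (beta_gt0 : 0 < beta) (lambda_gt0 : 0 < lambda) (delta_ge0 : 0 <= delta)
  (sigma_gt0 : 0 < sigma) (alpha_ge0 : forall k, 0 <= alpha k)
  (Mg_gt0 : 0 < Mg) (Lg_gt0 : 0 < Lg)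
  (g_bound : forall x, enorm (fd_grad f sigma x) <= Mg)
  (g_lip : forall x y,
     enorm (fd_grad f sigma x - fd_grad f sigma y) <= Lg * enorm (x - y))
  (xin_ac : distribution P xin `<< @lebesgue_rV R d)
  (x0_law : forall i, same_law (x0 i) xin)
  (eta_law : forall k l B, measurable B ->
     distribution P (eta k l) B = gaussian_law 0 delta B)
  (* the x^{i,0} and the eta^k_l are all together mutually independent *)
  (indep : mutually_independent P
     (fun j : 'I_N + nat * 'I_d =>
        match j with
        | inl i => sigma_of (x0 i)
        | inr kl => sigma_of (eta kl.1 kl.2)
        end))
  (lambda_delta : (1 - lambda) ^+ 2 + delta ^+ 2 < 1 / 2)
  (alpha_sum : cvgn (series alpha))
  (xinf_lim : forall i : 'I_N, {ae P, forall w,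
     escbo f beta lambda sigma alpha (fun j => x0 j w)
       (fun k => \row_l eta k l w) k i @[k --> \oo] --> (xinf w : 'rV[R]_d)})
  (eps_gt0 : 0 < eps) (eps_lt1 : eps < 1)
  (hbeta : ((beta * Lf)%:E * C3 P xin lambda delta Mg Lg alpha
              * (expR (- beta * f xstar))%:E
            <= (1 - eps)%:E * laplace P xin f beta)%E) :
  (`| ess_inf P (fun w => (f (xinf w))%:E) - (f xstar)%:E |
     <= (error P xin f (f xstar) eps beta)%:E)%E
  /\
  (* the support condition is needed here, see support_rV *)
  (support_rV (distribution P xin) xstar ->
   error P xin f (f xstar) eps b @[b --> +oo] --> 0).
Proof.
have [fmin _] := f_min.
split; last exact: (@error_cvg0 _ _ _ _ P xin f Lf xstar).
have mxin := rV_coord_measurable xin.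
have Lfin := laplace_fin_num xin f_lip fmin (ltW beta_gt0).
have L0 := laplace_gt0 xin f_lip beta.
pose term n := ((lambda + delta)%:E *
   sqrte (2%:E * (\prod_(0 <= m < n) C1 lambda delta Lg alpha m)%:E
               * variance_rV P xin) + (alpha n * Mg)%:E)%E.
have term0 n : (0 <= term n)%E.
  rewrite adde_ge0 ?mule_ge0 ?sqrte_ge0// lee_fin ?addr_ge0 ?mulr_ge0//; exact: ltW.
have part k : (\sum_(0 <= n < k) term n <= C3 P xin lambda delta Mg Lg alpha)%E.
  by apply: nneseries_lim_ge => n _ _; exact: term0.
have bL0 : 0 < beta * Lf by rewrite mulr_gt0.
(* An infinite [C3] would make the left side of [hbeta] infinite, while its right side is finite. *)
have C3y : (C3 P xin lambda delta Mg Lg alpha < +oo)%E.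
  rewrite ltNge leye_eq; apply/negP => /eqP C3E; move: hbeta.
  rewrite C3E gt0_muley ?lte_fin// gt0_mulye ?lte_fin ?expR_gt0// leye_eq.
  by rewrite -(fineK Lfin).
(* The term n = 0 of [C3] has an empty product and the positive coefficient lambda + delta, so an
   infinite variance would make it infinite. *)
have Vy : (variance_rV P xin < +oo)%E.
  rewrite ltNge leye_eq; apply/negP => /eqP Vy.
  have := le_lt_trans (part 1%N) C3y.
  rewrite big_nat1 /term big_nil Vy mule1 gt0_muley//= gt0_muley ?lte_fin ?addye//.
  by rewrite ltr_pwDl.
have X2 := variance_rV_lty_moment Vy.
have Vdev := variance_rV_dev X2.
set c0 := \row_l _ in Vdev.
have V0 : (0 <= variance_rV P xin)%E.
  by rewrite -Vdev; apply: EX_ge0 => w; exact: sqr_ge0.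
have Vfin : variance_rV P xin \is a fin_num by rewrite ge0_fin_numE.
pose v := fine (variance_rV P xin).
have v0 : 0 <= v by rewrite fine_ge0.
have x0_spread i :
    (\int[P]_w (enorm ((x0 i w : 'rV[R]_d) - c0) ^+ 2)%:E <= v%:E)%E.
  rewrite /v fineK// -Vdev.
  rewrite (@same_law_EX _ _ _ P _ _ (x0 i) xin
    (fun x : rVborel R d => enorm ((x : 'rV[R]_d) - c0) ^+ 2))//.
  - apply: measurable_funX; apply: measurable_enorm => l.
    rewrite (_ : (fun _ => _) = fun x : rVborel R d => (x : 'rV[R]_d) 0 l - c0 0 l).
      by apply: measurable_funB => //; exact: rVborel_coord_measurable.
    by apply/funext => x; rewrite !mxE.
  - by move=> x; exact: sqr_ge0.
pose mw := mean_weight (P := P) f beta lambda sigma alpha x0 eta.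
have mw_le := EX_mean_weight_le hN Lf_gt0 f_lip fmin beta_gt0 lambda_gt0
  delta_ge0 alpha_ge0 Mg_gt0 Lg_gt0 g_bound g_lip eta_law indep x0_spread v0.
have mmw k : measurable_fun setT (mw k) by exact: measurable_mean_weight f_lip _.
have mw_bnd k w : 0 <= mw k w <= expR (- beta * f xstar).
  exact: mean_weight_bounds.
have mf0 : measurable_fun setT (fun x : rVborel R d => expR (- beta * f (x : 'rV[R]_d))).
  apply: (measurable_laplace_weight f_lip) => l; exact: rVborel_coord_measurable.
have mw0 : (\int[P]_w (mw 0%N w)%:E = laplace P xin f beta)%E.
  rewrite laplaceE /mw /mean_weight EX_Zl//; last 2 first.
  - apply: measurable_sum => i; exact: (measurableT_comp mf0).
  - by move=> w; apply: sumr_ge0 => i _; exact: expR_ge0.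
  rewrite EX_sum; last 2 first.
  - by move=> i; exact: (measurableT_comp mf0).
  - by move=> i w; exact: expR_ge0.
  rewrite -laplaceE (eq_bigr (fun=> laplace P xin f beta)); last first.
    move=> i _; rewrite laplaceE.
    exact: (same_law_EX (x0_law i) mf0 (fun x => expR_ge0 _)).
  rewrite -(fineK Lfin) sumEFin -EFinM sumr_const card_ord.
  by rewrite -(mulr_natl (fine _)) mulKf// pnatr_eq0 -lt0n.
(* The losses up to step k are a partial sum of [C3], so by [hbeta] they consume at most the
   fraction 1 - eps of the initial functional. *)
have mw_ge k : ((eps * fine (laplace P xin f beta))%:E <= \int[P]_w (mw k w)%:E)%E.
  have termE n : term n = (drift lambda delta Mg Lg v alpha n)%:E.
    by rewrite /term -(fineK Vfin) /drift /spread_bound -!EFinM /= -?EFinM -?EFinD.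
  have := part k; rewrite (eq_bigr _ (fun n _ => termE n)) sumEFin => Sk.
  have := mw_le k; rewrite -/mw mw0.
  set S := \sum_(0 <= n < k) _ in Sk *.
  have Sle : ((beta * Lf * expR (- beta * f xstar) * S)%:E <=
      (1 - eps)%:E * laplace P xin f beta)%E.
    apply: le_trans hbeta.
    rewrite mulrAC EFinM lee_wpmul2r ?lee_fin ?expR_ge0// EFinM lee_wpmul2l//.
    by rewrite lee_fin ltW.
  move=> H; have {H} := le_trans H (leeD2l _ Sle).
  have -> : laplace P xin f beta = (fine (laplace P xin f beta))%:E by rewrite fineK.
  move: (fine (laplace P xin f beta)) => l /=.
  have m0 : (0 <= \int[P]_w (mw k w)%:E)%E.
    by apply: EX_ge0 => w; case/andP: (mw_bnd k w).
  move: (\int[P]_w (mw k w)%:E)%E m0 => -[m| |]// _; rewrite ?leey//.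
  by rewrite -EFinM -EFinD !lee_fin; lra.
have lim : ((eps * fine (laplace P xin f beta))%:E <=
    \int[P]_w (expR (- beta * f (xinf w : 'rV[R]_d)))%:E)%E.
  have cg : continuous (fun x : 'rV[R]_d => expR (- beta * f x)).
    have cf := elipschitz_continuous f_lip.
    move=> x; apply: (continuous_comp (f := fun y => - beta * f y) (g := expR)).
      by apply: continuousM; [exact: cst_continuous|exact: cf].
    exact: continuous_expR.
  have mwE : {ae P, forall w, (fun k => (mw k w)%:E) @ \oo -->
      (expR (- beta * f (xinf w : 'rV[R]_d)))%:E}.
    (* The exceptional null sets, one per particle, are finitely many and can be merged. *)
    have : {ae P, forall w, forall i : 'I_N, escbo f beta lambda sigma alpha
        (fun j => x0 j w) (fun k => \row_l eta k l w) k i @[k --> \oo]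
        --> (xinf w : 'rV[R]_d)} by exact: filter_forall.
    apply: filterS => w wcv; apply: cvg_EFin; first exact: nearW.
    have -> : expR (- beta * f (xinf w : 'rV[R]_d)) =
        N%:R^-1 * \sum_(i < N) expR (- beta * f (xinf w : 'rV[R]_d)).
      by rewrite sumr_const card_ord -(mulr_natl (expR _)) mulKf// pnatr_eq0 -lt0n.
    apply: cvgM; first exact: cvg_cst.
    apply: cvg_big => [|i _]; first exact: add_continuous.
    exact: (cvg_comp _ _ (wcv i) (cg _)).
  have [|||||_ _] := @dominated_convergence _ _ _ P setT measurableT
    (fun k w => (mw k w)%:E)
    (fun w => (expR (- beta * f (xinf w : 'rV[R]_d)))%:E)
    (fun=> (expR (- beta * f xstar))%:E).
  - by move=> k; exact/measurable_EFinP.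
  - by apply/measurable_EFinP; exact: (measurableT_comp mf0).
  - by apply: filterS mwE.
  - exact: finite_measure_integrable_cst.
  - apply: aeW => w k _ /=; have /andP[m0 m1] := mw_bnd k w.
    by rewrite lee_fin ger0_norm.
  by move=> cv; apply: cvge_ge cv; apply: nearW => k; exact: mw_ge.
have r0 : 0 < eps * fine (laplace P xin f beta).
  by rewrite mulr_gt0// fine_gt0// L0/= -ge0_fin_numE// ltW.
have mfinf : measurable_fun setT (fun w => f (xinf w : 'rV[R]_d)).
  exact: (measurable_lipschitz_comp f_lip (rV_coord_measurable xinf)).
have up := ess_inf_le_laplace mfinf beta_gt0 r0 lim.
have lo : ((f xstar)%:E <= ess_inf P (fun w => (f (xinf w))%:E))%E.
  by apply: ess_inf_ler => w; rewrite lee_fin.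
move: (ess_inf P _) lo up => -[x| |]//; rewrite !lee_fin => lo up.
rewrite ger0_norm ?subr_ge0//.
apply: (le_trans (lerB up (lexx _))).
(* The logarithm of eps times the functional splits, which produces the term - ln eps / beta of the
   error. *)
rewrite /error lnM ?posrE//; last by move: r0; rewrite pmulr_rgt0.
lra.
Qed.
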